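(* Let $a,n\in \mathbb{Z}$ with $a\ge 1$ and $n\ge 2$. If $\gcd(a,n)=1$, then there exist infinitely many primes $p$ such that \[f_{n,a,p}(x)=x^n-ax^{n-1}-p\] is a monogenic strictly-Perron polynomial.
   Context: A monic polynomial $f(x)\in\mathbb{Z}[x]$ of degree $n$ is called monogenic if $f(x)$ is irreducible over $\mathbb{Q}$ and $\{1,\theta,\theta^2,\ldots,\theta^{n-1}\}$ is a basis for the ring of integers of $\mathbb{Q}(\theta)$, where $f(\theta)=0$. A Perron number is a real algebraic integer $\lambda>1$ such that $|\alpha|<\lambda$ for every Galois conjugate $\alpha\neq\lambda$ of $\lambda$; a Perron polynomial is the minimal polynomial of a Perron number. A Pisot number is a real algebraic integer $\lambda>1$ all of whose other conjugates have modulus less than $1$. A Salem number is a real algebraic integer $\lambda>1$ of even degree at least $4$ such that $\lambda^{-1}$ is a conjugate of $\lambda$ and all conjugates other than $\lambda,\lambda^{-1}$ have modulus exactly $1$. An anti-Pisot number is a real algebraic integer $\lambda>1$ such that exactly one conjugate of $\lambda$ has modulus less than $1$ and at least one conjugate other than $\lambda$ has modulus greater than $1$. A strictly-Perron polynomial is the minimal polynomial of a Perron number that is neither a Pisot number, an anti-Pisot number, nor a Salem number. *)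

(* Defs.v *)
From mathcomp Require Import all_boot all_order all_algebra all_field.

Set Implicit Arguments.
Unset Strict Implicit.
Unset Printing Implicit Defensive.

Import Order.TTheory GRing.Theory Num.Theory.
Local Open Scope ring_scope.

(* All algebraic numbers live in [algC], the algebraic closure of the
   rationals with its complex modulus. The order of [algC] is partial:
   [1 < x] holds only for real [x]. *)

Definition conjugate (lambda alpha : algC) : Prop :=
  root (minCpoly lambda) alpha.

Definition alg_degree (lambda : algC) : nat := (size (minCpoly lambda)).-1.

Definition real_algint_gt1 (lambda : algC) : Prop :=
  [/\ lambda \is Num.real, lambda \in Aint & 1 < lambda].

Definition perron (lambda : algC) : Prop :=
  real_algint_gt1 lambda /\
  forall alpha, conjugate lambda alpha -> alpha <> lambda -> `|alpha| < lambda.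

Definition pisot (lambda : algC) : Prop :=
  real_algint_gt1 lambda /\
  forall alpha, conjugate lambda alpha -> alpha <> lambda -> `|alpha| < 1.

Definition salem (lambda : algC) : Prop :=
  [/\ real_algint_gt1 lambda,
      ~~ odd (alg_degree lambda) /\ (4 <= alg_degree lambda)%N,
      conjugate lambda lambda^-1
    & forall alpha, conjugate lambda alpha ->
        alpha <> lambda -> alpha <> lambda^-1 -> `|alpha| = 1].

Definition anti_pisot (lambda : algC) : Prop :=
  [/\ real_algint_gt1 lambda,
      exists! alpha, conjugate lambda alpha /\ `|alpha| < 1
    & exists alpha,
        [/\ conjugate lambda alpha, alpha <> lambda & 1 < `|alpha|]].

Definition is_min_poly (f : {poly int}) (lambda : algC) : Prop :=
  map_poly intr f = minCpoly lambda.

Definition strictly_perron_poly (f : {poly int}) : Prop :=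
  exists lambda : algC,
    [/\ is_min_poly f lambda, perron lambda, ~ pisot lambda,
        ~ anti_pisot lambda & ~ salem lambda].

(* Membership in the subfield Q(theta) of [algC]. *)
Definition in_Qadjoin (theta x : algC) : Prop :=
  exists p q : {poly rat},
    (map_poly ratr q).[theta] != 0 /\
    x = (map_poly ratr p).[theta] / (map_poly ratr q).[theta].

Definition in_ring_of_integers (theta x : algC) : Prop :=
  in_Qadjoin theta x /\ x \in Aint.

(* [b] is a Z-basis of the additive subgroup [S] of [algC]. *)
Definition is_Zbasis (n : nat) (b : 'I_n -> algC) (S : algC -> Prop) : Prop :=
  [/\ forall i, S (b i),
      forall x, S x -> exists c : 'I_n -> int, x = \sum_(i < n) (c i)%:~R * b i
    & forall c : 'I_n -> int,
        \sum_(i < n) (c i)%:~R * b i = 0 -> forall i, c i = 0].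

Definition monogenic (f : {poly int}) : Prop :=
  [/\ f \is monic,
      irreducible_poly (map_poly intr f : {poly rat})
    & forall theta : algC, root (map_poly intr f) theta ->
        is_Zbasis (fun i : 'I_(size f).-1 => theta ^+ i)
                  (in_ring_of_integers theta)].

Definition f_poly (n : nat) (a : int) (p : nat) : {poly int} :=
  'X^n - a *: 'X^(n.-1) - (p%:Z)%:P.

(* Main.v *)
Require Import Defs.
From mathcomp Require Import all_boot all_order all_algebra all_field.
From mathcomp Require Import zify ring lra.

Set Implicit Arguments.
Unset Strict Implicit.
Unset Printing Implicit Defensive.

Import Order.TTheory GRing.Theory Num.Theory.
Local Open Scope ring_scope.

(** Write f = X^n - a X^(n-1) - p and D = n^n p + a^n (n-1)^(n-1); up to sign the
    discriminant of f is p^(n-2) D.  For p > a + 1 every complex root of f has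
    modulus > 1.  As f(0) = -p is prime, f is then irreducible, and its positive
    root is a Perron number none of whose conjugates lies in the unit disc, so it
    is neither Pisot, anti-Pisot nor Salem.  By Dedekind's criterion f is
    monogenic as soon as D is squarefree: a multiple irreducible factor of f
    modulo a prime q divides f' = X^(n-2) (n X - a (n-1)), hence has an integer
    root c modulo q, with q^2 not dividing f(c).

    It remains to find infinitely many primes p with A p + B squarefree, where
    A = n^n and B = a^n (n-1)^(n-1) are coprime and A p + B is odd.  The primes
    p < N with q^2 | A p + B lie in one residue class modulo q^2, and Selberg's
    sieve bounds their number by about 2 N / (q (q-1) ln N).  Summed over odd
    q >= 3 this is less than 2 * 0.312 N / ln N, whereas Chebyshev's lower bound
    gives about ln 2 * N / ln N primes below N, and ln 2 > 0.624. *)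

(** * Selberg's sieve *)

(* The sum of the products of [w] over the prime factors of [e], for the squarefree
   [e <= x] with all prime factors in [ps]; iterated floor division of [x] by the
   chosen primes stays positive exactly when their product is at most [x]. *)
Fixpoint sqfsum (w : nat -> rat) (ps : seq nat) (x : nat) : rat :=
  if ps is p :: ps' then sqfsum w ps' x + w p * sqfsum w ps' (x %/ p)
  else (0 < x)%N%:R.

(** This is [mu(p) c_p(n) / phi(p)] with [c_p] the Ramanujan sum. The resulting
    [sqfsum (sieve_factor n) ps x] takes the place of Selberg's sum of weights over the divisors of
    [n]. *)
Definition sieve_factor (n p : nat) : rat :=
  if (p %| n)%N then -1 else (p%:R - 1)^-1.
Definition inv_pred (p : nat) : rat := (p%:R - 1)^-1.
(** [sieve_factor n p] is [1/(p-1)] minus [p/(p-1)] times the indicator of [p %| n]; this is the sum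
    of the absolute values of the two coefficients. *)
Definition err_factor (p : nat) : rat := (p%:R + 1) / (p%:R - 1).

Lemma count_mod_eq (N m r : nat) : (0 < m)%N ->
  (\sum_(0 <= n < N | n == r %[mod m]) 1 = (N + (m.-1 - r %% m)) %/ m)%N.
Proof.
move=> m0; have rm := ltn_pmod r m0.
elim: N => [|N IH].
  by rewrite big_geq // add0n divn_small //; lia.
rewrite big_mkcond big_nat_recr //= -big_mkcond IH addSn divnS // addnC.
congr (_ + _)%N.
suff -> : (N == r %[mod m]) = (m %| (N + (m.-1 - r %% m)).+1)%N by case: (_ %| _)%N.
have -> : ((N + (m.-1 - r %% m)).+1 = N + (m - r %% m))%N by lia.
rewrite -(eqn_modDr (m - r %% m)%N) /dvdn -(modnDml r) addnC.
by rewrite (addnC (r %% m)%N) subnK ?modnn 1?addnC // ltnW.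
Qed.

Lemma count_mod (N m r : nat) : (0 < m)%N ->
  `|(\sum_(0 <= n < N | n == r %[mod m]) 1 : rat) - N%:R / m%:R| <= 1.
Proof.
move=> m0; have rm := ltn_pmod r m0.
have -> : (\sum_(0 <= n < N | n == r %[mod m]) 1 : rat) =
    ((N + (m.-1 - r %% m)) %/ m)%:R.
  by rewrite -count_mod_eq // natr_sum.
set c := (m.-1 - r %% m)%N; set k := (_ %/ _)%N.
have m0' : 0 < m%:R :> rat by rewrite ltr0n.
have h1 : (k * m <= N + m)%N by have := leq_trunc_div (N + c) m; rewrite -/k; lia.
have h2 : (N <= k * m + m)%N.
  by have := ltn_ceil (N + c) m0; rewrite -/k mulSn; lia.
have {}h1 : k%:R * m%:R <= N%:R + m%:R :> rat by rewrite -natrM -natrD ler_nat.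
have {}h2 : N%:R <= k%:R * m%:R + m%:R :> rat by rewrite -natrM -natrD ler_nat.
have tE : N%:R / m%:R * m%:R = N%:R :> rat by rewrite divfK ?gt_eqF.
by rewrite ler_norml; apply/andP; split; rewrite -(ler_pM2r m0'); lra.
Qed.

Lemma sqfsum_ge0 w ps x : {in ps, forall p, 0 <= w p} -> 0 <= sqfsum w ps x.
Proof.
elim: ps x => [|p ps IH] x h /=; first exact: ler0n.
have h' : {in ps, forall p, 0 <= w p} by move=> q qps; rewrite h // inE qps orbT.
by rewrite addr_ge0 ?IH // mulr_ge0 ?IH // h // inE eqxx.
Qed.

Lemma eq_sqfsum w w' ps x : {in ps, w =1 w'} -> sqfsum w ps x = sqfsum w' ps x.
Proof.
elim: ps x => [|p ps IH] x h //=.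
have h' : {in ps, w =1 w'} by move=> q qps; rewrite h // inE qps orbT.
by rewrite !IH // h ?mem_head.
Qed.

Lemma leq_sqfsum w ps x y : {in ps, forall p, 0 <= w p} -> (x <= y)%N ->
  sqfsum w ps x <= sqfsum w ps y.
Proof.
elim: ps x y => [|p ps IH] x y h xy /=; first by rewrite ler_nat; lia.
have h' : {in ps, forall p, 0 <= w p} by move=> q qps; rewrite h // inE qps orbT.
by rewrite lerD ?IH // ler_wpM2l ?h ?mem_head // IH // leq_div2r.
Qed.

Lemma sqfsum_ge1 w ps x : {in ps, forall p, 0 <= w p} -> (0 < x)%N ->
  1 <= sqfsum w ps x.
Proof.
elim: ps x => [|p ps IH] x h x0 /=; first by rewrite x0.
have h' : {in ps, forall p, 0 <= w p} by move=> q qps; rewrite h // inE qps orbT.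
by rewrite -[1]addr0 lerD ?IH // mulr_ge0 ?sqfsum_ge0 // h ?mem_head.
Qed.

Lemma divn_minl m n d : (0 < d)%N -> (minn m n %/ d = minn (m %/ d) (n %/ d))%N.
Proof.
move=> d0; case: (leqP m n) => h.
  by rewrite (minn_idPl (leq_div2r d h)).
by rewrite (minn_idPr (leq_div2r d (ltnW h))).
Qed.

Section SecondMoment.
Variables (N m r : nat).

(** The divisor [d] and the separate cut-offs serve the recursion on [ps], which moves a prime into
    [d] and divides [x] or [y] by it. The sieve itself is the case [d = 1], [x = y]. *)
Definition moment (ps : seq nat) (d x y : nat) : rat :=
  \sum_(0 <= n < N | (n == r %[mod m]) && (d %| n)%N)
    sqfsum (sieve_factor n) ps x * sqfsum (sieve_factor n) ps y.

(** The factor at [p] is [al] minus [be] times the indicator of [p %| n], and its square is [al^2]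
    plus [1 - al^2] times that indicator; the condition [p %| n] is absorbed into [d]. *)
Lemma moment_rec p ps d x y : prime p -> coprime d p ->
  let al := inv_pred p in let be := p%:R * inv_pred p in
  moment (p :: ps) d x y = moment ps d x y
  + (al * moment ps d (x %/ p) y - be * moment ps (d * p) (x %/ p) y)
  + (al * moment ps d x (y %/ p) - be * moment ps (d * p) x (y %/ p))
  + (al ^+ 2 * moment ps d (x %/ p) (y %/ p)
     + (1 - al ^+ 2) * moment ps (d * p) (x %/ p) (y %/ p)).
Proof.
move=> pp dp al be.
have momentE ps' d' x' y' : moment ps' d' x' y' =
    \sum_(0 <= n < N) ((n == r %[mod m]) && (d' %| n)%N)%:R *
      (sqfsum (sieve_factor n) ps' x' * sqfsum (sieve_factor n) ps' y').
  rewrite /moment big_mkcond; apply: eq_bigr => n _.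
  by case: ifP => _; rewrite ?mul1r ?mul0r.
rewrite !momentE !mulr_sumr -!sumrN -!big_split /=.
apply: eq_bigr => n _; case: (n == r %[mod m]) => /=; last by ring.
rewrite Gauss_dvd //; case: (d %| n)%N => /=; last by ring.
have -> : sieve_factor n p = if (p %| n)%N then -1 else al by [].
case: (p %| n)%N => /=.
  have al1 : al * (p%:R - 1) = 1.
    by rewrite mulVf // subr_eq0 pnatr_eq1; apply: contraTneq pp => ->.
  have -> : be = 1 + al by rewrite /be -/al -[1 in RHS]al1; ring.
  by ring.
by ring.
Qed.

(* The factor at p has mean 0 and mean square 1/(p-1) over a period, so only
   the diagonal of the double sum contributes to the main term. *)
Lemma moment_bound ps d x y :
    (0 < m)%N -> (0 < d)%N -> uniq ps -> coprime m d ->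
    {in ps, forall p, [/\ prime p, coprime m p & coprime d p]} ->
  `|moment ps d x y - N%:R / (m * d)%:R * sqfsum inv_pred ps (minn x y)|
    <= sqfsum err_factor ps x * sqfsum err_factor ps y.
Proof.
move=> m0; elim: ps d x y => [|p ps IH] d x y d0 /= ups md hps.
  rewrite /moment /=.
  (* Chinese remaindering merges both conditions into one class modulo [m * d], whose count differs
     from [N / (m d)] by at most 1. *)
  have -> : \sum_(0 <= n < N | (n == r %[mod m]) && (d %| n)%N)
       ((0 < x)%N%:R * (0 < y)%N%:R : rat) =
     ((0 < x)%N%:R * (0 < y)%N%:R) *
       \sum_(0 <= n < N | n == chinese m d r 0 %[mod m * d]) 1.
    rewrite mulr_sumr; apply: eq_big => n; last by rewrite mulr1.
    rewrite chinese_remainder // chinese_modl // chinese_modr //.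
    by rewrite mod0n.
  have -> : ((0 < minn x y)%N%:R : rat) = (0 < x)%N%:R * (0 < y)%N%:R.
    by rewrite -natrM leq_min; case: (0 < x)%N; case: (0 < y)%N.
  rewrite [X in _ - X]mulrC -mulrBr normrM ger0_norm ?mulr_ge0 ?ler0n //.
  rewrite ler_piMr ?mulr_ge0 ?ler0n // count_mod // muln_gt0 m0 //.
have /andP[pnps ups'] := ups.
have [pp mp dp] := hps p (mem_head _ _).
have p1 := prime_gt1 pp; have p0 := prime_gt0 pp.
have hps' : {in ps, forall p, [/\ prime p, coprime m p & coprime d p]}.
  by move=> q qps; apply: hps; rewrite inE qps orbT.
have hps'' : {in ps, forall p', [/\ prime p', coprime m p' & coprime (d * p) p']}.
  move=> q qps; have [qp mq dq] := hps' q qps; split=> //.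
  rewrite coprimeMl dq /= prime_coprime // dvdn_prime2 //.
  by apply: contraNneq pnps => ->.
have A u v := IH d u v d0 ups' md hps'.
have dp0 : (0 < d * p)%N by rewrite muln_gt0 d0.
have mdp : coprime m (d * p) by rewrite coprimeMr md.
have B u v := IH (d * p)%N u v dp0 ups' mdp hps''.
rewrite moment_rec //.
set al := inv_pred p; set be := p%:R * al.
have p1' : 1 <= p%:R - 1 :> rat by have : 2%:R <= p%:R :> rat by [rewrite ler_nat]; lra.
have al0 : 0 < al by rewrite invr_gt0; lra.
have al1 : al <= 1 by rewrite invf_le1 //; lra.
have ale : al * (p%:R - 1) = 1 by rewrite mulVf //; lra.
have -> : err_factor p = al + be by rewrite /err_factor /be -/(inv_pred p) -/al; ring.
have be0 : 0 <= be by rewrite mulr_ge0 // ?ler0n // ltW.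
have be1 : 1 <= be by rewrite /be; lra.
rewrite divn_minl //.
set x' := (x %/ p)%N; set y' := (y %/ p)%N.
have := A x y; have := A x' y; have := A x y'; have := A x' y'.
have := B x' y; have := B x y'; have := B x' y'.
set U := sqfsum err_factor ps; set G := sqfsum inv_pred ps; set S := moment ps.
have Gm : [/\ U x >= 0, U y >= 0, U x' >= 0 & U y' >= 0].
  have W q : q \in ps -> 0 <= err_factor q.
    case/hps' => qp _ _; rewrite divr_ge0 // ?subr_ge0 ?addr_ge0 ?ler0n //.
    by rewrite ler1n prime_gt0.
  by split; apply: sqfsum_ge0.
set M := N%:R / (m * d)%:R.
have M' : N%:R / (m * (d * p))%:R = M / p%:R :> rat.
  by rewrite /M mulnA [in LHS]natrM invfM mulrA.
rewrite M'.
move=> f1 f2 f3 e1 e2 e3 e4.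
have pn0 : p%:R != 0 :> rat by rewrite pnatr_eq0 -lt0n.
(* [pV] and [q1] express the mean 0 and the mean square [al]. They let every moment below be
   replaced by its deviation from its main term. *)
have pV : be / p%:R = al by rewrite /be mulrAC divff ?mul1r.
have q1 : al ^+ 2 + (1 - al ^+ 2) / p%:R = al.
  apply: (mulIf pn0); rewrite mulrDl divfK //.
  by have : al * (al * (p%:R - 1)) = al; [rewrite ale mulr1 | lra].
have n0 : 0 <= 1 - al ^+ 2 by rewrite subr_ge0 exprn_ile1 // ltW.
have -> : S d x y + (al * S d x' y - be * S (d * p)%N x' y) +
  (al * S d x y' - be * S (d * p)%N x y') +
  (al ^+ 2 * S d x' y' + (1 - al ^+ 2) * S (d * p)%N x' y') -
  M * (G (minn x y) + al * G (minn x' y')) =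
  (S d x y - M * G (minn x y)) +
  (al * (S d x' y - M * G (minn x' y)) -
    be * (S (d * p)%N x' y - M / p%:R * G (minn x' y))) +
  (al * (S d x y' - M * G (minn x y')) -
    be * (S (d * p)%N x y' - M / p%:R * G (minn x y'))) +
  (al ^+ 2 * (S d x' y' - M * G (minn x' y')) + (1 - al ^+ 2) *
    (S (d * p)%N x' y' - M / p%:R * G (minn x' y'))).
  by rewrite -[X in M * (_ + X * _)]q1 -pV; ring.
have -> : (U x + (al + be) * U x') * (U y + (al + be) * U y') =
  U x * U y + (al * (U x' * U y) + be * (U x' * U y))
  + (al * (U x * U y') + be * (U x * U y')) + (al + be) ^+ 2 * (U x' * U y').
  by ring.
have K (c u v : rat) : 0 <= c -> `|u| <= v -> `|c * u| <= c * v.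
  by move=> c0 uv; rewrite normrM ger0_norm // ler_wpM2l.
have L (c c' u u' v : rat) : 0 <= c -> 0 <= c' -> `|u| <= v -> `|u'| <= v ->
    `|c * u - c' * u'| <= c * v + c' * v.
  move=> c0 c0' h h'; apply: (le_trans (ler_normB _ _)).
  by rewrite lerD // K.
case: Gm => Gx Gy Gx' Gy'.
apply: (le_trans (ler_normD _ _)); apply: lerD.
  apply: (le_trans (ler_normD _ _)); apply: lerD.
    apply: (le_trans (ler_normD _ _)); apply: lerD => //.
    by apply: L => //; exact: ltW.
  by apply: L => //; exact: ltW.
(* The coefficients of the last two deviations add up to 1, and [1 <= (al + be) ^+ 2]. *)
have z : U x' * U y' >= 0 by rewrite mulr_ge0.
apply: (@le_trans _ _ (U x' * U y')); last first.
  by rewrite ler_peMl // exprn_ege1 //; lra.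
apply: (le_trans (ler_normD _ _)).
have := K (al ^+ 2) _ _ (sqr_ge0 _) e1; have := K _ _ _ n0 f1; lra.
Qed.

End SecondMoment.

Lemma inv_pred_ge0 p : prime p -> 0 <= inv_pred p.
Proof. by move=> pp; rewrite invr_ge0 subr_ge0 ler1n prime_gt0. Qed.

(** A prime [n > D] is divisible by no element of [ps], so its sieve sum is
    [G = sqfsum inv_pred ps D]. The second moment is thus at least [G ^+ 2] times the count, while
    its main term is [N / m * G]. *)
Lemma selberg_bound (N m r D : nat) (ps : seq nat) :
    (0 < m)%N -> (0 < D)%N -> uniq ps ->
    {in ps, forall p, [/\ prime p, coprime m p & (p <= D)%N]} ->
  \sum_(0 <= n < N | [&& n == r %[mod m], prime n & (D < n)%N]) 1
    <= N%:R / (m%:R * sqfsum inv_pred ps D) + (sqfsum err_factor ps D) ^+ 2.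
Proof.
move=> m0 D0 ups hps.
have Gge1 : 1 <= sqfsum inv_pred ps D.
  by apply: sqfsum_ge1 => // p /hps[pp _ _]; exact: inv_pred_ge0.
have hps' : {in ps, forall p, [/\ prime p, coprime m p & coprime 1 p]}.
  by move=> p /hps[pp mp _]; rewrite coprime1n.
have := moment_bound N r D D m0 (ltn0Sn 0) ups (coprimen1 m) hps'.
rewrite muln1 minnn -expr2 => /(le_trans (ler_norm _)).
set G := sqfsum inv_pred ps D in Gge1 *.
set U := _ ^+ 2; set C := \sum_(_ <= n < _ | _) _.
have CG : C * G ^+ 2 <= moment N m r ps 1 D D.
  rewrite mulr_suml big_mkcond [leRHS]big_mkcond /=; apply: ler_sum => n _.
  rewrite dvd1n andbT; case: (n == r %[mod m]) => //=.
  case: ifP => [/andP[np Dn]|_]; last by rewrite -expr2 sqr_ge0.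
  rewrite mul1r expr2 (@eq_sqfsum (sieve_factor n) inv_pred) //.
  move=> p /hps[pp _ pD]; rewrite /sieve_factor dvdn_prime2 //.
  by rewrite ltn_eqF // (leq_ltn_trans pD).
have U0 : 0 <= U by rewrite sqr_ge0.
have G2 : 1 <= G ^+ 2 by rewrite exprn_ege1.
have m0' : 0 < m%:R :> rat by rewrite ltr0n.
have G0 : 0 < G by apply: lt_le_trans Gge1.
have G20 : 0 < G ^+ 2 by rewrite exprn_gt0.
move=> h; rewrite -(ler_pM2r G20) mulrDl.
have -> : N%:R / (m%:R * G) * G ^+ 2 = N%:R / m%:R * G.
  by field; rewrite !gt_eqF.
have : U <= U * G ^+ 2 by rewrite ler_peMr.
by lra.
Qed.

(** * Smooth numbers and the size of the sieve sums *)

Definition smooth_sum (f : nat -> rat) (ps : seq nat) (x : nat) : rat :=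
  \sum_(1 <= t < x.+1 | all (mem ps) (primes t)) f t.

Lemma smooth_sum0 (f : nat -> rat) (ps : seq nat) : smooth_sum f ps 0 = 0.
Proof. by rewrite /smooth_sum big_geq. Qed.

Lemma smooth_sumS (f : nat -> rat) (ps : seq nat) x : smooth_sum f ps x.+1 =
  smooth_sum f ps x + (if all (mem ps) (primes x.+1) then f x.+1 else 0).
Proof. by rewrite /smooth_sum big_mkcond big_nat_recr //= -big_mkcond. Qed.

(** The terms divisible by [p] are the [p * t] with [t] smooth and [t <= x %/ p]. In the induction
    on [x], the quotient [x %/ p] grows exactly when [p] divides the new index. *)
Lemma smooth_sum_rec (f : nat -> rat) (p : nat) (ps : seq nat) x :
    prime p -> p \notin ps ->
    (forall t, f (p * t)%N = f p * f t) ->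
  smooth_sum f (p :: ps) x
    = smooth_sum f ps x + f p * smooth_sum f (p :: ps) (x %/ p).
Proof.
move=> pp pnps fM; elim: x => [|x IH].
  by rewrite div0n !smooth_sum0 mulr0 addr0.
have p0 := prime_gt0 pp.
rewrite !smooth_sumS divnS // IH.
case: (boolP (p %| x.+1)%N) => px; last first.
  have -> : all (mem (p :: ps)) (primes x.+1) = all (mem ps) (primes x.+1).
    apply: eq_in_all => q; rewrite mem_primes => /and3P[_ _ qx] /=.
    rewrite inE; case: eqP => // qp; rewrite -qp qx in px; done.
  by rewrite add0n; ring.
rewrite add1n smooth_sumS.
have -> : all (mem ps) (primes x.+1) = false.
  apply/negP => /allP /(_ p); rewrite mem_primes pp px /= => /(_ isT) h.
  by rewrite h in pnps.
have e : x.+1 = (p * (x %/ p).+1)%N.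
  by have := divnS x p0; rewrite px add1n => <-; rewrite mulnC divnK.
have -> : all (mem (p :: ps)) (primes x.+1) =
    all (mem (p :: ps)) (primes (x %/ p).+1).
  apply/allP/allP => h q.
    move=> qq; apply: h; move: qq; rewrite !mem_primes => /and3P[-> _ qd] /=.
    by rewrite e dvdn_mull.
  rewrite mem_primes => /and3P[qp _]; rewrite e Euclid_dvdM // => /orP[|qd].
    by rewrite dvdn_prime2 // => /eqP ->; rewrite /= mem_head.
  by apply: h; rewrite mem_primes qp qd.
by case: ifP => _; rewrite ?[f x.+1](congr1 f e) ?fM; ring.
Qed.

Lemma smooth_sum_nil (f : nat -> rat) x :
  smooth_sum f [::] x = if (0 < x)%N then f 1%N else 0.
Proof.
elim: x => [|x IH]; first by rewrite smooth_sum0.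
have h : all (mem [::]) (primes x.+1) = (x.+1 < 2)%N.
  by rewrite -primes_eq0; case: primes.
rewrite smooth_sumS IH h; by case: x {IH h} => [|x] /=; rewrite ?add0r ?addr0.
Qed.

Lemma smooth_sum_ge0 (f : nat -> rat) (ps : seq nat) x :
  (forall t, 0 <= f t) -> 0 <= smooth_sum f ps x.
Proof. by move=> h; apply: sumr_ge0. Qed.

Lemma leq_smooth_sum (f : nat -> rat) (ps : seq nat) x y :
  (forall t, 0 <= f t) -> (x <= y)%N ->
  smooth_sum f ps x <= smooth_sum f ps y.
Proof.
move=> h /subnK <-; elim: (y - x)%N => [//|k IH]; rewrite addSn smooth_sumS.
by rewrite (le_trans IH) // lerDl; case: ifP.
Qed.

(* [1/(p-1)] is the sum of [p^-i] over [i >= 1]. *)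
Lemma smooth_sum_le_sqfsum (ps : seq nat) x : uniq ps -> {in ps, forall p, prime p} ->
  smooth_sum (fun t => t%:R^-1) ps x <= sqfsum inv_pred ps x.
Proof.
set f := fun t : nat => t%:R^-1 : rat.
have f0 t : 0 <= f t by rewrite invr_ge0 ler0n.
elim: ps x => [|p ps IH] x /=.
  by rewrite smooth_sum_nil; case: (0 < x)%N => //= _ _; rewrite /f invr1.
move=> /andP[pn ups] hps.
have pp : prime p by apply: hps; rewrite mem_head.
have p0 := prime_gt0 pp.
have p1 : 0 < p%:R - 1 :> rat by rewrite subr_gt0 ltr1n prime_gt1.
have al0 := inv_pred_ge0 pp.
have fM t : f (p * t)%N = f p * f t by rewrite /f natrM invfM.
have {}IH y : smooth_sum f ps y <= sqfsum inv_pred ps y.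
  by apply: IH => // q qps; apply: hps; rewrite inE qps orbT.
suff h : smooth_sum f (p :: ps) x <=
    smooth_sum f ps x + inv_pred p * smooth_sum f ps (x %/ p).
  by apply: (le_trans h); rewrite lerD // ler_wpM2l.
elim/ltn_ind: x => x IHx.
case: (posnP x) => [->|x0]; first by rewrite div0n !smooth_sum0 mulr0 addr0.
rewrite smooth_sum_rec // lerD2l.
have h := IHx (x %/ p)%N (ltn_Pdiv (prime_gt1 pp) x0).
(* The geometric series in closed form: [1/p * (1 + 1/(p-1)) = 1/(p-1)]. *)
apply: (@le_trans _ _ (f p * ((1 + inv_pred p) * smooth_sum f ps (x %/ p)))).
  rewrite ler_wpM2l // (le_trans h) // mulrDl mul1r lerD2l ler_wpM2l //.
  by apply: leq_smooth_sum => //; exact: leq_div.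
rewrite mulrA ler_wpM2r ?smooth_sum_ge0 // /f /inv_pred.
have pn0 : p%:R != 0 :> rat by rewrite pnatr_eq0 -lt0n.
by rewrite le_eqVlt; apply/orP; left; apply/eqP; field; rewrite pn0 gt_eqF.
Qed.

Lemma sqfsum1_le (ps : seq nat) x : uniq ps -> {in ps, forall p, prime p} ->
  sqfsum (fun=> 1) ps x <= x%:R.
Proof.
move=> ups hps; apply: (@le_trans _ _ (smooth_sum (fun=> 1) ps x)); last first.
  apply: (@le_trans _ _ (\sum_(1 <= t < x.+1) 1)).
    by rewrite /smooth_sum big_mkcond; apply: ler_sum => t _; case: ifP.
  by rewrite big_const_nat subSS subn0 iter_addr_0.
elim: ps x ups hps => [|p ps IH] x /=.
  by rewrite smooth_sum_nil; case: (0 < x)%N.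
move=> /andP[pn ups] hps.
have pp : prime p by apply: hps; rewrite mem_head.
have {}IH y : sqfsum (fun=> 1) ps y <= smooth_sum (fun=> 1) ps y.
  by apply: IH => // q qps; apply: hps; rewrite inE qps orbT.
rewrite smooth_sum_rec ?mulr1 // mul1r [in leRHS]mul1r lerD // (le_trans (IH _)) //.
rewrite /smooth_sum big_mkcond [leRHS]big_mkcond; apply: ler_sum => t _.
case: (boolP (all (mem ps) _)) => h; last by case: ifP.
suff -> : all (mem (p :: ps)) (primes t) by [].
by apply: sub_all h => q /= qps; rewrite inE qps orbT.
Qed.

(** This is the telescoping product of [(k+1)/(k-1)] over [k = 2, ..., w+1], which dominates the
    product of [err_factor] over any [w] distinct primes. *)
Definition tri (w : nat) : rat := (w.+1 * w.+2)%:R / 2.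

Lemma tri_mono w w' : (w <= w')%N -> tri w <= tri w'.
Proof. by move=> h; rewrite ler_pM2r // ler_nat leq_mul. Qed.

(** There is equality at [p = w + 2], and [err_factor] decreases with [p]. *)
Lemma err_factor_tri p w : (w.+2 <= p)%N -> err_factor p * tri w <= tri w.+1.
Proof.
move=> wp; rewrite /err_factor /tri !natrM.
have h : w%:R + 1 <= p%:R - 1 :> rat.
  by have : w.+2%:R <= p%:R :> rat; [rewrite ler_nat | rewrite -!natr1; lra].
have w0 : 0 <= w%:R :> rat := ler0n _ w.
have p1 : 0 < p%:R - 1 :> rat by lra.
rewrite mulrAC ler_pdivrMr //.
have eS k : k.+1%:R = k%:R + 1 :> rat by rewrite natr1.
rewrite (eS w.+2) (eS w.+1) (eS w).
have := h; set P : rat := p%:R - 1; have -> : p%:R + 1 = P + 2 by rewrite /P; ring.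
move=> {}h.
have : 0 <= (w%:R + 2) * (P - (w%:R + 1)) by rewrite mulr_ge0 //; lra.
by lra.
Qed.

Lemma err_factor_ge1 p : prime p -> 1 <= err_factor p.
Proof.
move=> /prime_gt1 p1; rewrite /err_factor ler_pdivlMr ?subr_gt0 ?ltr1n //.
by lra.
Qed.

Lemma size_lt_head (p : nat) (ps : seq nat) :
  path gtn p ps -> {in p :: ps, forall q, prime q} ->
  ((size ps).+2 <= p)%N.
Proof.
elim: ps p => [|p' ps IH] p /=.
  by move=> _ h; rewrite prime_gt1 // h // mem_head.
move=> /andP[pp' hp] h; apply: leq_ltn_trans pp'.
by apply: IH => // q qps; apply: h; rewrite inE qps orbT.
Qed.

(** A squarefree number below [2 ^ w] has at most [w] prime factors, so its product of error factors
    is at most [tri w]. *)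
Lemma err_sum_le (ps : seq nat) x w : sorted gtn ps -> {in ps, forall p, prime p} ->
  (x < 2 ^ w)%N -> sqfsum err_factor ps x <= tri w * sqfsum (fun=> 1) ps x.
Proof.
have step p qs y v : prime p -> (v.+2 <= p)%N ->
    0 <= sqfsum (fun=> 1) qs y ->
    sqfsum err_factor qs y <= tri v * sqfsum (fun=> 1) qs y ->
    err_factor p * sqfsum err_factor qs y <= tri v.+1 * (1 * sqfsum (fun=> 1) qs y).
  move=> pp vp h0 h; rewrite mul1r.
  have e0 : 0 <= err_factor p by apply: le_trans (err_factor_ge1 pp).
  apply: (le_trans (ler_wpM2l e0 h)); rewrite mulrA ler_wpM2r //.
  exact: err_factor_tri.
have C0 qs y : 0 <= sqfsum (fun=> 1) qs y by apply: sqfsum_ge0.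
have sz qs y : sorted gtn qs -> {in qs, forall p, prime p} ->
    sqfsum err_factor qs y <= tri (size qs) * sqfsum (fun=> 1) qs y.
  elim: qs y => [|p qs IH] y /=.
    by move=> _ _; rewrite /tri muln2 -muln2 natrM mulfK // mul1r.
  move=> hp hq.
  have hq' : {in qs, forall p, prime p}.
    by move=> q qps; apply: hq; rewrite inE qps orbT.
  have hs : sorted gtn qs by apply: path_sorted hp.
  rewrite mulrDr lerD //.
    by rewrite (le_trans (IH y hs hq')) // ler_wpM2r // tri_mono.
  apply: step => //; first by apply: hq; rewrite mem_head.
    exact: size_lt_head.
  exact: IH.
elim: ps x w => [|p qs IH] x w /= hp hq xw.
  by rewrite ler_peMl ?ler0n // (le_trans _ (tri_mono (leq0n w))).
have hq' : {in qs, forall p, prime p}.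
  by move=> q qps; apply: hq; rewrite inE qps orbT.
have hs : sorted gtn qs by apply: path_sorted hp.
have pp : prime p by apply: hq; rewrite mem_head.
have hsz := size_lt_head hp hq.
(* If [p <= w], the whole list has fewer than [w] primes and [sz] suffices. Otherwise [p] is large
   enough for [step], and [x %/ p] lies below the next smaller power of 2. *)
case: (ltnP w p) => wp; last first.
  have := sz (p :: qs) x hp hq => /= h; apply: (le_trans h).
  by rewrite ler_wpM2r ?addr_ge0 ?mul1r // tri_mono //; lia.
rewrite mulrDr lerD //; first exact: IH.
case: w xw wp => [|w] xw wp.
  have -> : x = 0%N by case: x xw.
  rewrite div0n; have z (f : nat -> rat) : sqfsum f qs 0 = 0.
    by elim: qs {IH hp hq hq' hs hsz} => //= q qs IH; rewrite div0n IH mulr0 addr0.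
  by rewrite !z !mulr0.
apply: step => //; apply: IH => //.
rewrite ltn_divLR ?prime_gt0 // (leq_trans xw) // expnS mulnC leq_mul2l.
by rewrite prime_gt1 // orbT.
Qed.

(** * Harmonic sums at powers of two *)

Definition harmonic (x : nat) : rat := \sum_(0 <= t < x) t.+1%:R^-1.

Lemma sum_even_odd (F : nat -> rat) n :
  \sum_(0 <= t < n.*2) F t = \sum_(0 <= t < n) (F t.*2 + F t.*2.+1).
Proof.
elim: n => [|n IH]; first by rewrite !big_geq.
by rewrite doubleS !big_nat_recr //= IH addrA.
Qed.

Lemma harmonic_double x :
  harmonic x.*2 = harmonic x + \sum_(0 <= t < x) (x + t).+1%:R^-1.
Proof.
rewrite /harmonic (@big_cat_nat _ _ _ x) //= -?addnn ?leq_addr //.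
congr (_ + _); rewrite -{1}[x]add0n big_addn addnK.
by apply: eq_bigr => t _; rewrite addnC.
Qed.

(** Of two consecutive terms in the longer block, the smaller is exactly half of the matching term
    in the shorter one. *)
Lemma harmonic_block_mono x :
  \sum_(0 <= t < x) (x + t).+1%:R^-1
    <= \sum_(0 <= t < x.*2) (x.*2 + t).+1%:R^-1 :> rat.
Proof.
rewrite sum_even_odd; apply: ler_sum => t _.
have e : (x.*2 + t.*2.+1).+1 = ((x + t).+1 * 2)%N by lia.
have -> : (x + t).+1%:R^-1 = (x.*2 + t.*2.+1).+1%:R^-1 *+ 2 :> rat.
  by rewrite e natrM invfM -[RHS]mulr_natr -mulrA mulVf // mulr1.
by rewrite mulr2n lerD2r lef_pV2 ?posrE ?ltr0n // ler_nat; lia.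
Qed.

Lemma sum8 (F : nat -> rat) : \sum_(0 <= t < 8) F t =
  F 0%N + (F 1%N + (F 2%N + (F 3%N + (F 4%N + (F 5%N + (F 6%N + F 7%N)))))).
Proof. by rewrite unlock /= addr0. Qed.

(** The dyadic blocks increase, and the block from 1/9 to 1/16 is the first to reach 33/50, an
    approximation from below to ln 2. *)
Lemma harmonic_ge j : (3 <= j)%N -> 33 / 50 * j%:R <= harmonic (2 ^ j).
Proof.
pose blk k : rat := \sum_(0 <= t < 2 ^ k) (2 ^ k + t).+1%:R^-1.
have hS k : harmonic (2 ^ k.+1) = harmonic (2 ^ k) + blk k.
  by rewrite expnS mul2n harmonic_double.
have bS k : blk k <= blk k.+1.
  by rewrite /blk expnS mul2n harmonic_block_mono.
have b3 : 33 / 50 <= blk 3%N.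
  by rewrite /blk -[(2 ^ 3)%N]/8%N sum8 !addnS addn0; lra.
have h3 : 33 / 50 * 3 <= harmonic (2 ^ 3).
  by rewrite /harmonic -[(2 ^ 3)%N]/8%N sum8; lra.
have b k : 33 / 50 <= blk (k + 3)%N.
  elim: k => [|k IH]; first exact: b3.
  by rewrite addSn; exact: le_trans IH (bS _).
move=> /subnK <-; elim: (j - 3)%N => [|k IH]; first exact: h3.
by rewrite addSn hS -[(k + 3).+1%:R]natr1 mulrDr mulr1; exact: lerD.
Qed.

(** * Chebyshev's lower bound *)

Section CentralBinomial.
Local Open Scope nat_scope.

(** Induction by [(2 m + 2) C(2 m + 2, m + 1) = 4 (2 m + 1) C(2 m, m)]. *)
Lemma central_bin_ge n : 0 < n -> 4 ^ n <= n.*2 * 'C(n.*2, n).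
Proof.
case: n => // n _; elim: n => [|n IH]; first by [].
set m := n.+1 in IH *; set c := 'C(m.*2, m) in IH *.
have e1 := mul_bin_diag (m.*2.+2) m.
have e2 := mul_bin_down (m.*2.+1) m.
rewrite /= in e1 e2; rewrite doubleS expnS.
set c1 := 'C(m.*2.+1, m) in e1 e2 *; set c2 := 'C(m.*2.+2, m.+1) in e1 *.
rewrite -/c in e2.
have e3 : m.*2.+1 - m = m.+1 by lia.
rewrite e3 in e2.
have h : m.*2.+2 * c2 = 4 * (m.*2.+1 * c).
  by rewrite e2 -doubleS -mul2n -mulnA -e1 -doubleS -mul2n -mulnA !mulnA.
by rewrite h leq_mul2l (leq_trans IH) ?orbT // leq_mul2r leqnSn orbT.
Qed.

(** By Legendre's formula the exponent is the sum over [k] of [2n %/ p^k - 2 (n %/ p^k)]; each term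
    is 0 or 1, and it is 0 once [p^k] exceeds [2 n]. *)
Lemma logn_central_bin p n : prime p -> 0 < n ->
  p ^ logn p 'C(n.*2, n) <= n.*2.
Proof.
move=> pp n0; have n20 : 0 < n.*2 by rewrite double_gt0.
suff h : logn p 'C(n.*2, n) <= trunc_log p n.*2.
  by apply: leq_trans (trunc_logP (prime_gt1 pp) n20); rewrite leq_exp2l ?prime_gt1.
have nn : n <= n.*2 by rewrite -addnn leq_addr.
have := bin_fact nn; have -> : n.*2 - n = n by lia.
move=> /(congr1 (logn p)); rewrite !lognM ?muln_gt0 ?fact_gt0 ?bin_gt0 //.
rewrite !logn_fact // addnn -(mul2n (\sum_(_ <= _ < _) _)).
have -> : \sum_(1 <= k < n.+1) n %/ p ^ k = \sum_(1 <= k < n.*2.+1) n %/ p ^ k.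
  rewrite [RHS](@big_cat_nat _ _ _ n.+1) //=.
  rewrite [X in _ = _ + X]big_nat_cond [X in _ = _ + X]big1 ?addn0 //.
  move=> k /andP[/andP[nk _] _].
  rewrite divn_small // (leq_ltn_trans (ltnW nk)) // ltn_expl // prime_gt1 //.
set t := trunc_log p n.*2.
have : \sum_(1 <= k < n.*2.+1) n.*2 %/ p ^ k <=
    \sum_(1 <= k < n.*2.+1) (2 * (n %/ p ^ k) + (k <= t)).
  rewrite big_nat [leqRHS]big_nat; apply: leq_sum => k /andP[k1 _].
  have pk0 : 0 < p ^ k by rewrite expn_gt0 prime_gt0.
  case: (leqP k t) => kt.
    have h1 := ltn_ceil n pk0; have h2 := leq_trunc_div n.*2 (p ^ k).
    rewrite -ltnS -(ltn_pmul2r pk0); apply: (leq_ltn_trans h2).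
    rewrite mulSn in h1; set X := _ * _; have : X = n %/ p ^ k * p ^ k * 2 + p ^ k * 2.
      by rewrite /X; lia.
    move=> ->; lia.
  rewrite divn_small //; have := trunc_log_ltn n.*2 (prime_gt1 pp).
  by move=> /leq_trans -> //; rewrite leq_exp2l ?prime_gt1.
rewrite big_split /= -big_distrr /= => h1 h2.
have : \sum_(1 <= k < n.*2.+1) (k <= t) <= t.
  elim: (n.*2.+1) => [|M IH]; first by rewrite big_geq.
  case: (posnP M) => [->|M0]; first by rewrite big_geq.
  rewrite big_nat_recr //=; case: (leqP M t) => Mt; last by rewrite addn0.
  apply: leq_trans Mt; rewrite -{2}(prednK M0) addn1 ltnS.
  apply: (@leq_trans (\sum_(1 <= k < M) 1)); last by rewrite sum_nat_const_nat muln1; lia.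
  by apply: leq_sum => k _; case: (k <= t).
by move=> h3; move: h1; rewrite -h2 addnC leq_add2l => /leq_trans; apply.
Qed.

Lemma prod_nat_const_seq (T : Type) (s : seq T) m : \prod_(i <- s) m = m ^ size s.
Proof. by rewrite big_const_seq count_predT; elim: size => //= k ->; rewrite expnS. Qed.

(** For [2 n = 2 ^ k] the two previous bounds give [4 ^ n <= (2 n) ^ (1 + pi(2 n))]; the claim
    compares exponents of 2. *)
Lemma prime_count_pow2 k : 1 < k ->
  2 ^ k <= k + k * \sum_(0 <= n < 2 ^ k | prime n) 1.
Proof.
case: k => // k k0; set n := 2 ^ k.
have n1 : 1 < n by rewrite -[1]/(2 ^ 0) ltn_exp2l.
have n0 : 0 < n := ltnW n1.
have n2 : 2 ^ k.+1 = n.*2 by rewrite expnS mul2n.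
have c0 : 0 < 'C(n.*2, n) by rewrite bin_gt0 -addnn leq_addr.
set s := primes 'C(n.*2, n).
have sz : size s <= \sum_(0 <= n < n.*2 | prime n) 1.
  rewrite sum1_count -size_filter; apply: uniq_leq_size; first exact: primes_uniq.
  move=> p; rewrite mem_primes => /and3P[pp _ pd].
  rewrite mem_filter pp mem_index_iota /=.
  have pf : p %| (n.*2)`!.
    have nn : n <= n.*2 by rewrite -addnn leq_addr.
    by rewrite -(bin_fact nn) dvdn_mulr.
  have : p <= n.*2.
    elim: (n.*2) pf => [|M IH]; first by rewrite fact0 dvdn1; case: p pp {pd} => [|[]].
    rewrite factS Euclid_dvdM // => /orP[/dvdn_leq -> //|/IH]; exact: leqW.
  (* The range stops short of [2 n], which is even and greater than 2, hence not prime. *)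
  rewrite leq_eqVlt => /orP[/eqP e|//].
  by case: (even_prime pp) => [e2|]; [lia | rewrite e odd_double].
have up : 'C(n.*2, n) <= n.*2 ^ size s.
  rewrite {1}(prod_prime_decomp c0) prime_decompE big_map /= -/s.
  rewrite big_seq; apply: (@leq_trans (\prod_(p <- s | p \in s) n.*2)).
    apply: leq_prod => p; rewrite mem_primes => /and3P[pp _ _].
    exact: logn_central_bin.
  by rewrite -big_seq prod_nat_const_seq.
have := central_bin_ge n0; rewrite -n2 in sz up *.
rewrite -[4]/(2 ^ 2) -expnM mul2n -n2 => h.
have {}h : 2 ^ 2 ^ k.+1 <= 2 ^ (k.+1 + k.+1 * size s).
  by rewrite (leq_trans h) // expnD leq_mul2l expnM up orbT.
rewrite leq_exp2l // in h; apply: (leq_trans h).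
by rewrite leq_add2l leq_mul2l sz orbT.
Qed.

Lemma exists_pow2_ge K e l0 : exists2 l, l0 < l & K * l ^ e <= 2 ^ l.
Proof.
(* For [l = (e+1) t] one has [2 ^ l = (2 ^ t) ^ (e+1) >= t ^ (e+1)], and [t >= K (e+1) ^ e] turns
   one factor [t] into the required constant. *)
set t := (e.+1 ^ e * K + l0).+1.
exists (e.+1 * t); first by rewrite /t mulSn; lia.
rewrite (mulnC e.+1 t) expnM; apply: (@leq_trans (t ^ e.+1)).
  rewrite expnS expnMn mulnCA mulnC -[leqRHS]mulnC mulnC leq_mul2l.
  by rewrite mulnC /t; apply/orP; right; lia.
by rewrite leq_exp2r // ltnW // ltn_expl.
Qed.
End CentralBinomial.

(** * Squarefree values at primes *)

(** The sieve modulo [q ^ 2] has to omit [q]. Restoring it multiplies the sum by at most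
    [1 + 1/(q-1) = q/(q-1)], and then every [t <= D] is smooth. *)
Lemma harmonic_le_sqfsum (D q : nat) (ps : seq nat) : prime q -> uniq (q :: ps) ->
    {in ps, forall p, prime p} ->
    (forall p, prime p -> (p <= D)%N -> p \in q :: ps) ->
  harmonic D <= q%:R * inv_pred q * sqfsum inv_pred ps D.
Proof.
move=> qp uqps hps full.
have hqps : {in q :: ps, forall p, prime p}.
  by move=> p; rewrite inE => /orP[/eqP -> //|/hps].
have -> : harmonic D = smooth_sum (fun t => t%:R^-1) (q :: ps) D.
  rewrite /smooth_sum big_add1 /= /harmonic big_nat [RHS]big_nat_cond.
  apply: eq_bigl => t; case: (ltnP t D) => tD; rewrite ?andbF ?andbT //=.
  apply/esym/allP => p; rewrite mem_primes => /and3P[pp _ pt].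
  by apply: full => //; rewrite (leq_trans (dvdn_leq _ pt)).
apply: (le_trans (smooth_sum_le_sqfsum D uqps hqps)) => /=.
have q1 : 0 < q%:R - 1 :> rat by rewrite subr_gt0 ltr1n prime_gt1.
have -> : q%:R * inv_pred q = 1 + inv_pred q by rewrite /inv_pred; field; rewrite gt_eqF.
rewrite mulrDl mul1r lerD2l ler_wpM2l ?inv_pred_ge0 //.
apply: leq_sqfsum; last exact: leq_div.
by move=> p /hps; exact: inv_pred_ge0.
Qed.

(** The loss [q/(q-1)] from omitting [q] turns [N / q^2] into [N / (q (q-1))]; the error uses that
    all [e <= 2 ^ j] lie below [2 ^ (j+1)]. *)
Lemma primes_mod_square_le (N q r j : nat) : prime q ->
  \sum_(0 <= n < N | [&& n == r %[mod q ^ 2], prime n & (2 ^ j < n)%N]) 1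
    <= N%:R / harmonic (2 ^ j) / (q%:R * (q%:R - 1))
       + (tri j.+1 * (2 ^ j)%:R) ^+ 2.
Proof.
move=> qp; set D := (2 ^ j)%N.
(* Reversed because [err_sum_le] takes the primes in decreasing order. *)
pose ps := [seq p <- rev (iota 0 D.+1) | prime p && (p != q)].
have D0 : (0 < D)%N by rewrite expn_gt0.
have mem_ps p : (p \in ps) = [&& prime p, p != q & (p <= D)%N].
  by rewrite mem_filter mem_rev mem_iota /= add0n ltnS andbA.
have ups : uniq ps by rewrite filter_uniq // rev_uniq iota_uniq.
have hps : {in ps, forall p, prime p} by move=> p; rewrite mem_ps => /and3P[].
have sps : sorted gtn ps.
  apply: sorted_filter; first by move=> a b c /= h1 h2; exact: ltn_trans h2 h1.
  by rewrite rev_sorted; exact: iota_ltn_sorted.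
have hps' : {in ps, forall p, [/\ prime p, coprime (q ^ 2) p & (p <= D)%N]}.
  move=> p; rewrite mem_ps => /and3P[pp pq pD]; split=> //.
  by rewrite coprimeXl // prime_coprime // dvdn_prime2 // eq_sym.
have q20 : (0 < q ^ 2)%N by rewrite expn_gt0 prime_gt0.
apply: (le_trans (selberg_bound N r q20 D0 ups hps')).
have G1 : 1 <= sqfsum inv_pred ps D.
  by apply: sqfsum_ge1 => // p /hps; exact: inv_pred_ge0.
have H1 : 1 <= harmonic D.
  rewrite /harmonic big_ltn // invr1 lerDl; apply: sumr_ge0 => t _.
  by rewrite invr_ge0 ler0n.
have q0 : 0 < q%:R :> rat by rewrite ltr0n prime_gt0.
have q1 : 0 < q%:R - 1 :> rat by rewrite subr_gt0 ltr1n prime_gt1.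
apply: lerD.
  have uqps : uniq (q :: ps) by rewrite /= ups mem_ps eqxx andbF.
  have full p : prime p -> (p <= D)%N -> p \in q :: ps.
    by move=> pp pD; rewrite inE mem_ps pp pD andbT; case: eqP.
  have := harmonic_le_sqfsum qp uqps hps full.
  set G := sqfsum _ _ _ in G1 *; set H := harmonic D in H1 * => h.
  rewrite -[leRHS]mulrA ler_wpM2l ?ler0n // -invfM lef_pV2 ?posrE; last first.
  - by rewrite !mulr_gt0 // (lt_le_trans ltr01).
  - by rewrite mulr_gt0 ?ltr0n // (lt_le_trans ltr01).
  rewrite natrX; have e : q%:R * inv_pred q * (q%:R - 1) = q%:R.
    by rewrite -mulrA mulVf ?mulr1 // gt_eqF.
  have h' := ler_wpM2r (ltW q1) h.
  have h'' := ler_wpM2r (ltW q0) h'.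
  rewrite [X in _ <= X * _]mulrAC e in h''.
  by rewrite expr2; lra.
have T0 w : 0 <= tri w by rewrite mulr_ge0 ?ler0n ?invr_ge0.
rewrite ler_sqr ?nnegrE ?mulr_ge0 ?ler0n //; last first.
  by apply: sqfsum_ge0 => p /hps /err_factor_ge1; exact: le_trans.
apply: (le_trans (err_sum_le sps hps (w := j.+1) _)); first by rewrite ltn_exp2l.
by rewrite ler_wpM2l ?sqfsum1_le.
Qed.

(** If some value is divisible by [q ^ 2], coprimality keeps [q] from dividing [A], so [A] cancels
    from the difference of two such values. If there is none, any residue will do. *)
Lemma square_dvd_residue (A B N q : nat) : prime q -> coprime A B ->
  exists r, forall n, (n < N)%N -> (q ^ 2 %| A * n + B)%N -> n == r %[mod q ^ 2].
Proof.
move=> qp AB.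
case: (boolP [exists r : 'I_N, q ^ 2 %| A * r + B]%N) => [/existsP[r hr]|/existsPn h].
  exists r => n _ hn.
  have qA : coprime (q ^ 2) A.
    rewrite coprimeXl // prime_coprime //; apply/negP => qA.
    have : (q %| A * n + B)%N by apply: dvdn_trans hn; exact: dvdn_exp.
    rewrite dvdn_addr ?dvdn_mulr // => qB.
    have : (q %| gcdn A B)%N by rewrite dvdn_gcd qA.
    by rewrite (eqP AB) dvdn1 => /eqP e; rewrite e in qp.
  wlog le : n r hr hn / (r <= n)%N.
    move=> W; case: (leqP r n) => [|/ltnW] rn; first exact: (W n r).
    have nN : (n < N)%N by apply: leq_ltn_trans rn (ltn_ord r).
    by rewrite eq_sym; apply: (W r (Ordinal nN)).
  rewrite eqn_mod_dvd // -(Gauss_dvdr _ qA) mulnBr.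
  have -> : (A * n - A * r = (A * n + B) - (A * r + B))%N by lia.
  exact: dvdn_sub.
exists 0%N => n nN hn; have := h (Ordinal nN); by rewrite hn.
Qed.

(** Here 131/420 is 1/6 + 1/20 + 1/42, the terms of 3, 5 and 7, plus 1/14 for the tail, which is
    telescoped after replacing [q (q-1)] by [(q-2) q]. *)
Lemma sum_inv_odd_mul_pred n :
  \sum_(0 <= i < n) ((i.*2 + 3)%:R * ((i.*2 + 3)%:R - 1))^-1 <= 131 / 420 :> rat.
Proof.
pose F i : rat := ((i.*2 + 3)%:R * ((i.*2 + 3)%:R - 1))^-1.
have F0 i : 0 <= F i.
  by rewrite invr_ge0 mulr_ge0 ?ler0n // subr_ge0 ler1n addn3.
rewrite -/F; apply: (@le_trans _ _ (\sum_(0 <= i < n + 3) F i)).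
  rewrite [leRHS](@big_cat_nat _ _ _ n) //= ?leq_addr // lerDl.
  exact: sumr_ge0.
suff : \sum_(0 <= i < n + 3) F i <= 131 / 420 - (2 * (2 * n%:R + 7))^-1.
  by move=> /le_trans; apply; rewrite gerBl invr_ge0; have := ler0n rat n; lra.
elim: n => [|n IH].
  have s3 (f : nat -> rat) :
      \sum_(0 <= i < 0 + 3) f i = f 0%N + (f 1%N + f 2%N).
    by rewrite unlock /= addr0.
  rewrite s3 /F -[(0.*2 + 3)%N]/3%N -[(1.*2 + 3)%N]/5%N -[(2.*2 + 3)%N]/7%N.
  have -> : 3 * (3 - 1) = 6 :> rat by ring.
  have -> : 5 * (5 - 1) = 20 :> rat by ring.
  have -> : 7 * (7 - 1) = 42 :> rat by ring.
  have -> : 2 * (2 * 0%:R + 7) = 14 :> rat by ring.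
  by lra.
rewrite addSn big_nat_recr; last by [].
apply: (le_trans (lerD IH (lexx _))).
have -> : F (n + 3)%N = ((2 * n%:R + 9) * (2 * n%:R + 8))^-1.
  rewrite /F; congr (_^-1); rewrite -muln2 !natrD natrM natrD; ring.
rewrite -[n.+1%:R]natr1; have := ler0n rat n; set x := n%:R => x0.
have e : (2 * (2 * x + 7))^-1 - (2 * (2 * (x + 1) + 7))^-1
  = ((2 * x + 7) * (2 * x + 9))^-1.
  by field; rewrite !gt_eqF //=; lra.
have : ((2 * x + 9) * (2 * x + 8))^-1 <= ((2 * x + 7) * (2 * x + 9))^-1.
  by rewrite lef_pV2 ?posrE ?mulr_gt0 //; lra.
by lra.
Qed.

Lemma sum_inv_odd_sqr (a b : nat) : (0 < a)%N ->
  \sum_(a <= i < b) ((i.*2 + 3)%:R ^+ 2)^-1 <= a%:R^-1 :> rat.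
Proof.
move=> a0; case: (leqP a b) => [ab|/ltnW ba]; last first.
  by rewrite big_geq // invr_ge0 ler0n.
suff : \sum_(a <= i < b) ((i.*2 + 3)%:R ^+ 2)^-1 <= a%:R^-1 - b%:R^-1 :> rat.
  by move=> /le_trans; apply; rewrite gerBl invr_ge0 ler0n.
rewrite -(subnK ab) addnC; elim: (b - a)%N => [|k IH].
  by rewrite addn0 big_geq // subrr.
rewrite addnS big_nat_recr ?leq_addr //= (le_trans (lerD IH (lexx _))) //.
set i := (a + k)%N; have i0 : 0 < i%:R :> rat by rewrite ltr0n /i addn_gt0 a0.
rewrite -muln2 natrD natrM -[i.+1%:R]natr1; set x := i%:R in i0 *.
have : ((x * 2 + 3) ^+ 2)^-1 <= (x * (x + 1))^-1.
  have xx := mulr_gt0 i0 i0.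
  by rewrite lef_pV2 ?posrE ?exprn_gt0 ?mulr_gt0 ?expr2 //; lra.
have -> : (x * (x + 1))^-1 = x^-1 - (x + 1)^-1.
  by field; rewrite !gt_eqF //; lra.
by lra.
Qed.

Lemma prime_sum_ge k : (1 < k)%N ->
  (2 ^ k)%:R / k%:R - 1 <= \sum_(0 <= n < 2 ^ k | prime n) 1 :> rat.
Proof.
move=> k1; have := prime_count_pow2 k1.
have k0 : 0 < k%:R :> rat by rewrite ltr0n ltnW.
rewrite -(ler_nat rat) natrD natrM natr_sum; set S := \sum_(_ <= _ < _ | _) _ => h.
by rewrite lerBlDr ler_pdivrMr // mulrDl mul1r addrC mulrC.
Qed.

Section SquarefreeValues.
Variables (A B l : nat).
Hypothesis cAB : coprime A B.

(** [D] stays just below the square root of [N]: [D ^ 2 = N / 2 ^ l] leaves room for the powers of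
    [l] in the sieve error. The index [i] of [hit] encodes the odd number [q = 2 i + 3]. *)
Let N := (2 ^ (25 * l))%N.
Let D := (2 ^ (12 * l))%N.
Let hit (n i : nat) := [&& prime n, (D < n)%N, prime (i.*2 + 3)
                         & ((i.*2 + 3) ^ 2 %| A * n + B)%N].
Let err : rat := (tri (12 * l).+1 * D%:R) ^+ 2.

(** All [n] hit by a given [q] share one residue modulo [q ^ 2], so a bound valid in every class is
    enough. *)
Let hit_sum_le (i : nat) (P : nat -> bool) (c : rat) : 0 <= c ->
    (forall n, hit n i -> P n) ->
    (forall r, prime (i.*2 + 3) ->
       \sum_(0 <= n < N | (n == r %[mod (i.*2 + 3) ^ 2]) && P n) 1 <= c) ->
  \sum_(0 <= n < N) (hit n i)%:R <= c.
Proof.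
move=> c0 hP hc; case: (boolP (prime (i.*2 + 3))) => qp; last first.
  by rewrite big1 // => n _; rewrite /hit (negPf qp) !andbF.
have [r hr] := square_dvd_residue N qp cAB.
apply: le_trans (hc r qp); rewrite [leRHS]big_mkcond [leLHS]big_nat [leRHS]big_nat.
apply: ler_sum => n /andP[_ nN]; case: (boolP (hit n i)) => h; last by case: ifP.
by rewrite (hP n h) andbT hr //; case/and4P: h.
Qed.

Let hit_sum_small (i : nat) : \sum_(0 <= n < N) (hit n i)%:R <=
  N%:R / harmonic D * ((i.*2 + 3)%:R * ((i.*2 + 3)%:R - 1))^-1 + err.
Proof.
have c0 : 0 <= harmonic D by apply: sumr_ge0 => t _; rewrite invr_ge0 ler0n.
apply: (@hit_sum_le i (fun n => prime n && (D < n)%N)).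
- rewrite addr_ge0 ?sqr_ge0 // mulr_ge0 ?divr_ge0 ?ler0n //.
  by rewrite invr_ge0 mulr_ge0 ?ler0n // subr_ge0 ler1n addn3.
- by move=> n /and4P[-> ->].
- by move=> r qp; exact: primes_mod_square_le.
Qed.

Let hit_sum_large (i : nat) : \sum_(0 <= n < N) (hit n i)%:R <=
  N%:R * ((i.*2 + 3)%:R ^+ 2)^-1 + 1 :> rat.
Proof.
have q0 : (0 < (i.*2 + 3) ^ 2)%N by rewrite expn_gt0 addn3.
apply: (@hit_sum_le i predT) => //.
  by rewrite addr_ge0 // divr_ge0 ?ler0n ?sqr_ge0.
move=> r _; under eq_bigl => n do rewrite andbT.
have /(le_trans (ler_norm _)) := count_mod N r q0.
by rewrite natrX; lra.
Qed.

(** The sieve saves a logarithm but costs [err] for each [q], so it is applied for [i < I] only;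
    beyond [I] the trivial count [N / q^2 + 1] is already summable. *)
Lemma hit_total_le (I J : nat) : (0 < I <= J)%N ->
  \sum_(0 <= i < J) \sum_(0 <= n < N) (hit n i)%:R <=
    N%:R / harmonic D * (131 / 420) + I%:R * err + N%:R / I%:R + J%:R.
Proof.
move=> /andP[I0 IJ]; rewrite (@big_cat_nat _ _ _ I) //= -[leRHS]addrA.
have c0 : 0 <= harmonic D by apply: sumr_ge0 => t _; rewrite invr_ge0 ler0n.
apply: lerD.
  apply: (le_trans (ler_sum _ (fun i _ => hit_sum_small i))).
  rewrite big_split /= -mulr_sumr big_const_nat iter_addr_0 subn0 -[err *+ I]mulr_natl lerD2r.
  apply: ler_wpM2l; first by rewrite divr_ge0 ?ler0n.
  exact: sum_inv_odd_mul_pred.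
apply: (le_trans (ler_sum _ (fun i _ => hit_sum_large i))).
rewrite big_split /= -mulr_sumr lerD // ?ler_wpM2l ?ler0n ?sum_inv_odd_sqr //.
by rewrite big_const_nat iter_addr_0 ler_nat leq_subr.
Qed.

(** A union bound, with [D + 1] accounting for all [n <= D]. It prepares a contradiction with the
    lower bound on the number of primes. *)
Lemma prime_sum_le (J : nat) :
    (forall n, (n < N)%N -> prime n -> (D < n)%N -> has (hit n) (iota 0 J)) ->
  \sum_(0 <= n < N | prime n) 1 <=
    D%:R + 1 + \sum_(0 <= i < J) \sum_(0 <= n < N) (hit n i)%:R :> rat.
Proof.
move=> h; rewrite exchange_big /=.
apply: (@le_trans _ _ (\sum_(0 <= n < N)
   ((n < D.+1)%N%:R + \sum_(0 <= i < J) (hit n i)%:R))).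
  rewrite big_mkcond [leLHS]big_nat [leRHS]big_nat; apply: ler_sum => n /andP[_ nN].
  have S0 : 0 <= \sum_(0 <= i < J) (hit n i)%:R :> rat by apply: sumr_ge0.
  case: ifP => pn; last by rewrite addr_ge0 ?ler0n.
  case: (ltnP n D.+1) => nD; first by rewrite lerDl.
  have /hasP[i iJ hi] := h n nN pn nD.
  rewrite add0r (bigD1_seq i) ?iota_uniq ?/index_iota ?subn0 //= hi lerDl.
  by apply: sumr_ge0.
rewrite big_split lerD2r /= natr1.
have : (\sum_(0 <= n < N) (n < D.+1) <= D.+1)%N.
  elim: (N) => [|M IH]; first by rewrite big_geq.
  rewrite big_nat_recr //=; case: (ltnP M D.+1) => MD; last by rewrite addn0.
  rewrite addn1; apply: leq_trans MD; rewrite ltnS.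
  apply: (@leq_trans (\sum_(0 <= k < M) 1)); last by rewrite sum_nat_const_nat subn0 muln1.
  by apply: leq_sum => k _; case: (k < _)%N.
by rewrite -(ler_nat rat) natr_sum.
Qed.
End SquarefreeValues.

(** The constant is the value [14 * 15 / 2] at [l = 1], the worst case. *)
Lemma tri_le l : (0 < l)%N -> tri (12 * l).+1 <= (105 * l ^ 2)%:R.
Proof.
move=> l0; rewrite /tri ler_pdivrMr // -[2]/(2%:R) -natrM ler_nat.
by rewrite expnS expn1; nia.
Qed.

(* With N = 2^(25 l) the primes below N number about N/(25 l), while those with
   a square factor contribute at most (131/420) N/(0.66 * 12 l): the theorem
   rests on 131/420 * 25 < 0.66 * 12. *)
Lemma infinitely_many_primes_squarefree (A B N0 : nat) :
    coprime A B -> (forall n, odd n -> odd (A * n + B)) ->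
  exists p, [/\ (N0 < p)%N, prime p & forall q, prime q -> ~~ (q ^ 2 %| A * p + B)%N].
Proof.
move=> cAB hodd.
(* [M] is the factor by which each error term must fall below the scale [N / l]. The constants enter
   through existentials so that large numerals and powers stay opaque. *)
have [M [M0 Mr]] : exists M, (0 < M)%N /\
    forall u : rat, u * M%:R = u * (100 * 100).
  by exists (100 * 100)%N; split=> [|u]; rewrite ?natrM.
have [z [z0 hz]] : exists z, (0 < z)%N /\
    forall l, (0 < l)%N -> tri (12 * l).+1 <= (z * l ^ 2)%:R.
  by exists 105%N; split; [|exact: tri_le].
have [Z ZE] : exists Z, Z = (z ^ 2)%N by exists (z ^ 2)%N.
have [l l0' hl] := exists_pow2_ge (M * M * Z * (A + B + 1)) 7 N0.
have l0 : (0 < l)%N by apply: leq_ltn_trans l0'.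
have [y [yE y1]] : exists y, y = (2 ^ l)%N /\ (1 < y)%N.
  by exists (2 ^ l)%N; split; [|rewrite -(expn0 2) ltn_exp2l].
have [N [NE Ny]] : exists N, N = (2 ^ (25 * l))%N /\ N = (y ^ 25)%N.
  by exists (2 ^ (25 * l))%N; split; [|rewrite yE mulnC expnM].
have [D [DE Dy]] : exists D, D = (2 ^ (12 * l))%N /\ D = (y ^ 12)%N.
  by exists (2 ^ (12 * l))%N; split; [|rewrite yE mulnC expnM].
rewrite -yE in hl.
(* [I] is chosen so that [N / I] is the scale divided by [M]. [J] bounds every [q] with
   [q ^ 2 <= A n + B], because [A n + B <= (A + B) y ^ 25]. *)
pose I := (M * l)%N; pose J := (I + (A + B) * y ^ 13)%N.
have leK (e c : nat) : (e <= 7)%N -> (c <= M * M * Z * (A + B + 1))%N ->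
    (c * l ^ e <= y)%N.
  by move=> e7 cK; apply: leq_trans hl; apply: leq_mul cK _; rewrite leq_pexp2l.
have z20 : (0 < Z)%N by rewrite ZE expn_gt0 z0.
have ABS : (0 < A + B + 1)%N by rewrite addn1.
have leM : (M * l <= y)%N.
  have := leK 1%N M isT; rewrite expn1; apply.
  by rewrite -!mulnA leq_pmulr // !muln_gt0 M0 z20.
have leMAB : (M * (A + B) * l <= y)%N.
  have := leK 1%N (M * (A + B))%N isT; rewrite expn1; apply.
  apply: leq_mul; last exact: leq_addr.
  by rewrite -mulnA leq_pmulr // muln_gt0 M0.
have leMM : (M * M * l ^ 2 <= y)%N.
  by apply: (leK 2%N (M * M)%N isT); rewrite -mulnA leq_pmulr // muln_gt0 z20.
have leMMz : (M * M * Z * l ^ 6 <= y)%N.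
  by apply: (leK 6%N _ isT); rewrite leq_pmulr.
have powle (e f : nat) : (e <= f)%N -> (y ^ e <= y ^ f)%N.
  by rewrite leq_exp2l.
pose E : rat := (tri (12 * l).+1 * D%:R) ^+ 2; pose H := harmonic D.
have L0 : 0 < l%:R :> rat by rewrite ltr0n.
pose x : rat := N%:R / l%:R.
have Nx : N%:R = x * l%:R by rewrite /x divfK // gt_eqF.
have x0 : 0 < x by rewrite divr_gt0 // ltr0n NE expn_gt0.
have M0' : 0 < M%:R :> rat by rewrite ltr0n.
have bound (u : nat) : (M * (l * u) <= N)%N -> u%:R * M%:R <= x.
  rewrite -(ler_nat rat) !natrM => hu; rewrite /x ler_pdivlMr //; lra.
have b1 : (D + 2)%:R * M%:R <= x.
  apply: bound; rewrite Ny Dy mulnA (leq_trans (leq_mul leM (leqnn _))) //.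
  have h4 : (1 <= y ^ 12)%N by rewrite expn_gt0 (ltnW y1).
  apply: (@leq_trans (y * (y ^ 2 * y ^ 12))); last by rewrite -expnD -expnS powle.
  rewrite leq_mul2l; apply/orP; right; have := leq_mul y1 y1.
  by rewrite -mulnn; nia.
have b2 : J%:R * M%:R <= x.
  apply: bound; rewrite Ny /J /I !mulnDr.
  apply: (@leq_trans (y ^ 24 + y ^ 24)); last first.
    by rewrite addnn -mul2n expnS leq_mul2r y1 orbT.
  apply: leq_add.
    have -> : (M * (l * (M * l)) = M * M * l ^ 2)%N by rewrite -mulnn; lia.
    by rewrite (leq_trans leMM) // -{1}[y]expn1 powle.
  have -> : (M * (l * ((A + B) * y ^ 13)) = M * (A + B) * l * y ^ 13)%N by lia.
  rewrite (leq_trans (leq_mul leMAB (leqnn _))) //.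
  by rewrite -expnS powle.
have b3 : I%:R * E * M%:R <= x.
  apply: (@le_trans _ _ ((I * (z * l ^ 2 * D) ^ 2)%:R * M%:R)).
    rewrite ler_wpM2r ?ler0n // natrM ler_wpM2l ?ler0n // natrX ler_sqr ?nnegrE.
    - by rewrite natrM ler_wpM2r ?ler0n ?hz.
    - by rewrite !mulr_ge0 ?ler0n ?invr_ge0.
    - exact: ler0n.
  apply: bound; rewrite Ny (leq_trans _ (powle _ _ (leqnn 25))) // expnS.
  apply: leq_trans (leq_mul leMMz (leqnn (y ^ 24))).
  have -> : (y ^ 24 = D * D)%N by rewrite Dy -expnD.
  have -> : (l ^ 6 = l * l * (l * l) * (l * l))%N by rewrite !expnS expn0 muln1 !mulnA.
  by rewrite /I ZE -!mulnn; lia.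
have b4 : N%:R / I%:R * M%:R = x.
  by rewrite /x /I natrM; field; rewrite !gt_eqF.
have b5 : N%:R / H <= x * (25 / 198).
  rewrite Nx -[leLHS]mulrA; apply: ler_wpM2l; first exact: ltW.
  have : 33 / 50 * (12 * l)%:R <= H by rewrite /H DE; apply: harmonic_ge; lia.
  rewrite natrM => hH; have H0 : 0 < H by lra.
  by rewrite ler_pdivrMr; [lra | exact: H0].
have b6 : N%:R / (25 * l)%:R = x / 25.
  by rewrite /x natrM; field; rewrite !gt_eqF.
(* The gap between [1/25] and [(131/420) (25/198)] exceeds [6/10000], while the four errors [b1] to
   [b4] take up [4/10000] in all. *)
have X : (forall n, (n < N)%N -> prime n -> (D < n)%N ->
    has (fun i => [&& prime n, (D < n)%N, prime (i.*2 + 3)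
                    & ((i.*2 + 3) ^ 2 %| A * n + B)%N]) (iota 0 J)) -> False.
  rewrite {1}NE DE => /(prime_sum_le).
  have IJ : (0 < I <= J)%N by rewrite muln_gt0 M0 l0 leq_addr.
  have := hit_total_le l cAB IJ; have := @prime_sum_ge (25 * l) ltac:(by lia).
  rewrite -NE -DE -/E -/H.
  set S := \sum_(_ <= _ < J) _; set P := \sum_(_ <= _ < N | _) 1.
  move: b1 b2 b3; rewrite b6 natrD !Mr; move: b4; rewrite Mr.
  set y1' := N%:R / I%:R; set y2 := N%:R / H in b5 *; set y3 := I%:R * E.
  lra.
have /existsP[n /and3P[pn Dn nohit]] : [exists n : 'I_N,
   [&& prime n, (D < n)%N
     & ~~ has (fun i => [&& prime n, (D < n)%N, prime (i.*2 + 3)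
                    & ((i.*2 + 3) ^ 2 %| A * n + B)%N]) (iota 0 J)]].
  case: (boolP [exists n : 'I_N, _]) => // /existsPn h; case: X => n nN pn Dn.
  by have := h (Ordinal nN); rewrite /= pn Dn /= negbK.
have N0D : (N0 < D)%N.
  rewrite (ltn_trans l0') // DE (leq_trans (ltn_expl l (leqnn 2))) //.
  by rewrite leq_exp2l // leq_pmull.
exists n; split => //; first exact: ltn_trans Dn.
move=> q qp; apply/negP => qd.
(* Only odd [q] were counted; [q = 2] is excluded because [n > D] is odd and so [A n + B] is odd. *)
have n_odd : odd n.
  case: (even_prime pn) => // n2; move: Dn; rewrite n2 DE.
  by rewrite ltnNge -{1}(expn1 2) leq_exp2l // muln_gt0 l0.
have q_odd : odd q.
  case: (even_prime qp) => // q2; have := hodd n n_odd.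
  have : (2 %| A * n + B)%N by apply: dvdn_trans qd; rewrite q2.
  by rewrite dvdn2 => /negPf ->.
have q3 : (2 < q)%N by rewrite odd_prime_gt2.
have qE : q = ((q - 3)./2.*2 + 3)%N.
  by rewrite halfK oddB // q_odd /= subn0 subnK.
case/negP: nohit; apply/hasP; exists (q - 3)./2; last by rewrite pn Dn -qE qp.
rewrite mem_iota add0n /= (@leq_trans q) //; first by lia.
have y0 : (0 < y)%N := ltnW y1.
have {}qd : (q ^ 2 <= A * n + B)%N.
  apply: dvdn_leq => //; have := hodd n n_odd; by case: (A * n + B)%N.
rewrite (leq_trans _ (leq_addl _ _)) // -(@leq_exp2r _ _ 2) //.
apply: (leq_trans qd); apply: (@leq_trans ((A + B) * N)).
  rewrite mulnDl leq_add // ?leq_mul2l ?(ltnW (ltn_ord n)) ?orbT // leq_pmulr //.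
  exact: leq_ltn_trans (ltn_ord n).
rewrite expnMn -expnM leq_mul //.
  by rewrite -mulnn; case: (A + B)%N => // s; rewrite leq_pmulr.
by rewrite Ny powle.
Qed.

(** * Dedekind's criterion *)

(** Over a finite field irreducibility is decidable, so a reducible polynomial yields an explicit
    proper factor to recurse on. *)
Lemma exists_irreducible_factor (F : finFieldType) (p : {poly F}) :
  (1 < size p)%N -> exists2 g : {poly F}, irreducible_poly g & g %| p.
Proof.
have [k] := ubnP (size p); elim: k p => // k IH p pk p1.
case: (boolP (irreducibleb p)) => [/irreducibleP|]; first by exists p.
rewrite negb_and p1 /= negb_forall => /existsP[g].
rewrite negb_imply -ltnNge -Pdiv.Idomain.dvdpE => /andP[gp g1].
have gk : (size (g : {poly F}) < k)%N.
  by apply: leq_ltn_trans (size_npoly g) _; rewrite -ltnS prednK // (ltnW p1).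
by have [h irrh hg] := IH _ gk g1; exists h => //; exact: dvdp_trans gp.
Qed.

Lemma map_poly_intr_rat (R : numFieldType) (p : {poly int}) :
  map_poly ratr (map_poly intr p : {poly rat}) = map_poly intr p :> {poly R}.
Proof.
by rewrite -map_poly_comp; apply: eq_map_poly => z; rewrite /= rmorph_int.
Qed.

(** * Reduction of integer polynomials modulo a prime *)

Section Reduction.
Variable q : nat.
Hypothesis qp : prime q.

Definition polymod (p : {poly int}) : {poly 'F_q} := map_poly intr p.
(** Only a set-theoretic section of [polymod], taking least nonnegative representatives: it respects
    sums and products merely modulo [q]. *)
Definition polylift (p : {poly 'F_q}) : {poly int} :=
  map_poly (fun x : 'F_q => (x : nat)%:Z) p.

Lemma polyliftK p : polymod (polylift p) = p.
Proof.
rewrite /polymod /polylift; apply/polyP => i; rewrite coef_map /= coef_map_id0 //.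
by rewrite -pmulrn natr_Zp.
Qed.

Lemma intr_Fp_eq0 (z : int) : (z%:~R == 0 :> 'F_q) = (q %| z)%Z.
Proof. by rewrite (dvdz_pcharf (pchar_Fp qp)). Qed.

Lemma polymod_eq0 p : polymod p = 0 -> exists p', p = q%:Z *: p'.
Proof.
move=> p0; exists (map_poly (divz^~ q%:Z) p); rewrite map_poly_divzK //.
apply/polyOverP => i; rewrite -intr_Fp_eq0.
by have := coef_map (intr : int -> 'F_q) p i; rewrite [map_poly _ _]p0 coef0 => ->.
Qed.

Lemma polymod_horner p (c : int) : (polymod p).[c%:~R] = (p.[c])%:~R.
Proof. exact: horner_map. Qed.
End Reduction.

(** * The ring Z[theta] and integral elements *)

Section IntegralElement.
Variable theta : algC.

Definition evalZ (g : {poly int}) : algC := (map_poly intr g).[theta].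

Lemma evalZD g h : evalZ (g + h) = evalZ g + evalZ h.
Proof. by rewrite /evalZ rmorphD hornerD. Qed.
Lemma evalZM g h : evalZ (g * h) = evalZ g * evalZ h.
Proof. by rewrite /evalZ rmorphM hornerM. Qed.
Lemma evalZN g : evalZ (- g) = - evalZ g.
Proof. by rewrite /evalZ rmorphN hornerN. Qed.
Lemma evalZC (c : int) : evalZ c%:P = c%:~R.
Proof. by rewrite /evalZ map_polyC hornerC. Qed.
Lemma evalZZ (c : int) g : evalZ (c *: g) = c%:~R * evalZ g.
Proof. by rewrite -mul_polyC evalZM evalZC. Qed.

Definition inZ (x : algC) := exists g, x = evalZ g.

Lemma inZ_eval g : inZ (evalZ g). Proof. by exists g. Qed.
Lemma inZ_int (c : int) : inZ c%:~R. Proof. by exists c%:P; rewrite evalZC. Qed.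
Lemma inZD x y : inZ x -> inZ y -> inZ (x + y).
Proof. by move=> [g ->] [h ->]; exists (g + h); rewrite evalZD. Qed.
Lemma inZM x y : inZ x -> inZ y -> inZ (x * y).
Proof. by move=> [g ->] [h ->]; exists (g * h); rewrite evalZM. Qed.
Lemma inZN x : inZ x -> inZ (- x).
Proof. by move=> [g ->]; exists (- g); rewrite evalZN. Qed.
Lemma inZX x k : inZ x -> inZ (x ^+ k).
Proof.
move=> hx; elim: k => [|k IH]; first by rewrite expr0; exact: (inZ_int 1).
by rewrite exprS; exact: inZM.
Qed.

(* Multiplying an integral equation of degree k for y by t^(k-1) gives
   y (yt)^(k-1) in Z[theta], and yt = 1 modulo s, which y maps into Z[theta]. *)
Lemma inZ_of_integral y t s : y \in Aint -> inZ t -> inZ s ->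
  y * t = 1 + s -> inZ (y * s) -> inZ y.
Proof.
move=> yA ht hs yt hys.
have down k : inZ (y * (1 + s) ^+ k) -> inZ y.
  elim: k => [|k IH]; first by rewrite mulr1.
  move=> h; apply: IH.
  have -> : y * (1 + s) ^+ k = y * (1 + s) ^+ k.+1 - y * s * (1 + s) ^+ k.
    by rewrite exprS; ring.
  apply: inZD => //; apply/inZN/inZM => //; apply/inZX/inZD => //.
  exact: (inZ_int 1).
have /floorpP[p Dp] : minCpoly y \is a polyOver Num.int by [].
have sp : size (minCpoly y) = size p by rewrite Dp size_map_inj_poly //; exact: intr_inj.
have := root_minCpoly y; rewrite rootE horner_coef.
have := size_minCpoly y; rewrite sp; case E : (size p) => [//|[//|k]] _.
rewrite big_ord_recr /=.
have -> : (minCpoly y)`_k.+1 = 1.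
  by have /monicP := minCpoly_monic y; rewrite /lead_coef sp E.
rewrite mul1r addrC addr_eq0 => /eqP yk.
apply: (down k); rewrite -yt exprMn mulrA -exprS yk mulNr; apply: inZN.
rewrite mulr_suml; elim/big_rec: _ => [|i x _ hx]; first exact: (inZ_int 0).
apply: inZD => //; have ik : (i <= k)%N by rewrite -ltnS.
have -> : (minCpoly y)`_i * y ^+ i * t ^+ k
    = (p`_i)%:~R * ((y * t) ^+ i * t ^+ (k - i)).
  have -> : t ^+ k = t ^+ i * t ^+ (k - i) by rewrite -exprD subnKC.
  by rewrite Dp coef_map /= exprMn; ring.
apply: inZM; first exact: inZ_int.
by apply: inZM; apply: inZX => //; rewrite yt; apply: inZD => //; exact: (inZ_int 1).
Qed.
End IntegralElement.

Section DedekindCriterion.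
Variable f : {poly int}.
Hypothesis f_monic : f \is monic.
Hypothesis f_irr : irreducible_poly (map_poly intr f : {poly rat}).
Variable theta : algC.
Hypothesis f_theta : root (map_poly intr f) theta.

Local Notation evalZ := (evalZ theta).
Local Notation inZ := (inZ theta).

Lemma minCpoly_irreducible : minCpoly theta = map_poly intr f.
Proof.
have [p [Dp p_monic] hp] := minCpolyP theta.
have fQ_monic : (map_poly intr f : {poly rat}) \is monic by rewrite monic_map.
have pf : p %| map_poly intr f by rewrite -hp map_poly_intr_rat.
have sp : size p != 1%N.
  by have := size_minCpoly theta; rewrite Dp size_map_poly; case: (size p) => [|[]].
have := apply_irredp f_irr sp pf; rewrite eqp_monic // => /eqP pE.
by rewrite Dp pE map_poly_intr_rat.
Qed.

Lemma root_ratpolyE (g : {poly rat}) :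
  root (map_poly ratr g) theta = (map_poly intr f %| g).
Proof.
have [p [Dp p_monic] ->] := minCpolyP theta.
suff -> : p = map_poly intr f by [].
apply: (@map_poly_inj _ _ (ratr : rat -> algC)).
by rewrite -Dp minCpoly_irreducible map_poly_intr_rat.
Qed.

Lemma evalZ_f : evalZ f = 0. Proof. exact/eqP. Qed.

(** Division by the monic [f] stays in Z[X], and a remainder vanishing at [theta] is 0 since [f] is
    the minimal polynomial. *)
Lemma evalZ_eq0 g : evalZ g = 0 -> exists k, g = k * f.
Proof.
move=> g0; rewrite [g](Pdiv.RingMonic.rdivp_eq f_monic).
set k := Pdiv.CommonRing.rdivp _ _; set r := Pdiv.CommonRing.rmodp _ _; exists k.
suff -> : r = 0 by rewrite addr0.
have r0 : evalZ r = 0.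
  by move: g0; rewrite [g in evalZ g](Pdiv.RingMonic.rdivp_eq f_monic)
    evalZD evalZM evalZ_f mulr0 add0r.
have : map_poly intr f %| (map_poly intr r : {poly rat}).
  by rewrite -root_ratpolyE map_poly_intr_rat; apply/eqP.
have sr : (size r < size f)%N by rewrite Pdiv.CommonRing.ltn_rmodp monic_neq0.
move=> /dvdp_leq h; apply/eqP; apply: contraTT sr => rn0; rewrite -leqNgt.
have := h; rewrite map_poly_eq0_id0 ?intr_eq0 ?lead_coef_eq0 // => /(_ rn0).
by rewrite !size_map_inj_poly //; exact: intr_inj.
Qed.

Lemma Aint_theta : theta \in Aint.
Proof.
apply: root_monic_Aint f_theta _ _; first by rewrite monic_map.
by apply/polyOverP => i; rewrite coef_map /= intr_int.
Qed.

Lemma Aint_evalZ g : evalZ g \in Aint.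
Proof.
rewrite /evalZ horner_coef rpred_sum // => i _; rewrite rpredM ?rpredX ?Aint_theta //.
by rewrite coef_map /= Aint_int.
Qed.

(** That is, [q] does not divide the index of Z[theta] in the ring of integers: an integral
    [g(theta) / q] already lies in Z[theta]. *)
Definition locally_maximal (q : nat) := forall g,
  evalZ g / q%:R \in Aint -> exists g' k, g = q%:Z *: g' + k * f.

(** The denominator is cleared one prime factor at a time. *)
Lemma inZ_div (m : nat) g : (0 < m)%N -> (forall q, prime q -> locally_maximal q) ->
  evalZ g / m%:R \in Aint -> inZ (evalZ g / m%:R).
Proof.
move=> m0 hmax; elim/ltn_ind: m => m IH in m0 g *.
case: (ltngtP m 1%N) => [|m1|->]; first by rewrite ltnNge m0.
  have [q qp /dvdnP[m' mE]] : exists2 q, prime q & (q %| m)%N.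
    by exists (pdiv m); rewrite ?pdiv_prime ?pdiv_dvd.
  have q0 : q%:R != 0 :> algC by rewrite pnatr_eq0 -lt0n prime_gt0.
  have m'0 : (0 < m')%N by move: m0; rewrite mE muln_gt0 => /andP[].
  have m'0' : m'%:R != 0 :> algC by rewrite pnatr_eq0 -lt0n.
  move=> gA.
  have gq : evalZ g / q%:R \in Aint.
    have -> : evalZ g / q%:R = m'%:R * (evalZ g / m%:R).
      by rewrite mE natrM; field; rewrite q0 m'0'.
    by rewrite rpredM // rpred_nat.
  have [g' [k gE]] := hmax q qp g gq.
  have e : evalZ g / m%:R = evalZ g' / m'%:R.
    rewrite gE evalZD evalZM evalZ_f mulr0 addr0 evalZZ mE natrM -pmulrn.
    by field; rewrite q0 m'0'.
  rewrite e in gA *; apply: IH => //.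
  by rewrite mE ltn_Pmulr // prime_gt1.
by rewrite divr1 => _; exact: inZ_eval.
Qed.

(** A Bezout relation with [f] inverts the denominator at [theta], so [x] becomes a polynomial in
    [theta] over an integer [m], and [inZ_div] applies. *)
Lemma inZ_ring_of_integers x : (forall q, prime q -> locally_maximal q) ->
  in_ring_of_integers theta x -> inZ x.
Proof.
move=> hmax [[a [b [b0 xE]]] xA].
have cop : coprimep (map_poly intr f) b.
  by rewrite irreducible_poly_coprime // -root_ratpolyE.
have [[u v] /= uv] := Bezout_eq1_coprimepP _ _ cop.
have vb : (map_poly ratr v).[theta] * (map_poly ratr b).[theta] = 1.
  have /(congr1 (fun p => (map_poly ratr p).[theta] : algC)) := uv.
  rewrite rmorphD !rmorphM /= rmorph1 hornerD !hornerM hornerC.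
  by rewrite map_poly_intr_rat (rootP f_theta) mulr0 add0r.
have {}xE : x = (map_poly ratr (a * v)).[theta].
  rewrite xE rmorphM hornerM; apply: (mulIf b0).
  by rewrite divfK // -mulrA vb mulr1.
have [g [d d0 gE]] := rat_poly_scale (a * v).
have {}xE : x = evalZ g / d%:~R.
  rewrite xE gE map_polyZ hornerZ map_poly_intr_rat mulrC.
  by rewrite fmorphV /= rmorph_int.
have [g' [m [m0 xE']]] : exists g' m, (0 < m)%N /\ x = evalZ g' / m%:R.
  case: d d0 {gE} xE => m d0 xE; first by exists g, m; rewrite lt0n.
  exists (- g), m.+1; split=> //.
  by rewrite xE evalZN NegzE rmorphN invrN mulrN mulNr.
by rewrite xE' in xA *; apply: inZ_div.
Qed.

Lemma is_Zbasis_powers : (forall q, prime q -> locally_maximal q) ->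
  is_Zbasis (fun i : 'I_(size f).-1 => theta ^+ i) (in_ring_of_integers theta).
Proof.
move=> hmax.
have f0 : (0 < size f)%N by rewrite size_poly_gt0 monic_neq0.
have sumE (r : {poly int}) : (size r <= (size f).-1)%N ->
    evalZ r = \sum_(i < (size f).-1) (r`_i)%:~R * theta ^+ i.
  move=> sr; rewrite /evalZ (@horner_coef_wide _ (size f).-1).
    by apply: eq_bigr => i _; rewrite coef_map.
  by rewrite (leq_trans (size_poly _ _)).
split.
- move=> i; split; last by rewrite rpredX ?Aint_theta.
  exists 'X^i, 1; rewrite rmorph1 hornerC oner_neq0; split=> //.
  by rewrite divr1 map_polyXn hornerXn.
- move=> x /(inZ_ring_of_integers hmax)[g ->].
  exists (fun i => (Pdiv.CommonRing.rmodp g f)`_i); rewrite -sumE.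
    by rewrite [in LHS](Pdiv.RingMonic.rdivp_eq f_monic g)
      evalZD evalZM evalZ_f mulr0 add0r.
  by rewrite -ltnS prednK // Pdiv.CommonRing.ltn_rmodp monic_neq0.
- move=> c c0 i.
  pose r := \poly_(i < (size f).-1) (if insub i is Some j then c j else 0).
  have rE (j : 'I_(size f).-1) : r`_j = c j.
    by rewrite coef_poly ltn_ord valK.
  have sr : (size r <= (size f).-1)%N by exact: size_poly.
  have /evalZ_eq0[k rk] : evalZ r = 0.
    by rewrite sumE // -[RHS]c0; apply: eq_bigr => j _; rewrite rE.
  rewrite -rE; suff -> : r = 0 by rewrite coef0.
  apply/eqP; apply: contraTT sr => rn0; rewrite -ltnNge prednK // rk.
  have kn0 : k != 0 by apply: contraNneq rn0 => k0; rewrite rk k0 mul0r.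
  by rewrite size_Mmonic // -(prednK (n := size k)) ?size_poly_gt0 // addSn /= leq_addl.
Qed.
(** If local maximality fails, the failure can be moved to [y = h(theta) / q] with [h] lifting
    [f / ir] for an irreducible factor [ir] of [f] modulo [q]. Then [ir ^+ 2] divides [f] modulo
    [q], and [q ^ 2] divides [f] at every integer root of [ir]. *)
Lemma dedekind_locally_maximal q : prime q ->
    (forall g : {poly 'F_q}, irreducible_poly g -> g ^+ 2 %| polymod q f ->
       exists2 c : int, root g c%:~R & ~~ (q%:Z ^+ 2 %| f.[c])%Z) ->
  locally_maximal q.
Proof.
move=> qp hyp g gA; set fb := polymod q f; set gb := polymod q g.
have modD p1 p2 : polymod q (p1 + p2) = polymod q p1 + polymod q p2.
  exact: rmorphD.
have modN p1 : polymod q (- p1) = - polymod q p1 by exact: rmorphN.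
have modM p1 p2 : polymod q (p1 * p2) = polymod q p1 * polymod q p2.
  exact: rmorphM.
have modq p1 : polymod q (q%:Z *: p1) = 0.
  rewrite -mul_polyC modM /polymod map_polyC /= (_ : _%:~R = 0) ?mul0r //.
  by apply/eqP; rewrite intr_Fp_eq0.
case: (boolP (fb %| gb)) => [/dvdpP[kb gE]|fg].
  have [|g' g'E] := @polymod_eq0 q qp (g - polylift kb * f).
    by rewrite modD modN modM polyliftK -/gb gE subrr.
  by exists g', (polylift kb); rewrite -g'E subrK.
have fb0 : fb != 0 by rewrite monic_neq0 // monic_map.
set d := gcdp gb fb; set e := fb %/ d.
have fE : e * d = fb by rewrite divpK // dvdp_gcdr.
have d0 : d != 0 by apply: contraNneq fb0 => d0; rewrite -fE d0 mulr0.
have e0 : e != 0 by apply: contraNneq fb0 => e0; rewrite -fE e0 mul0r.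
have e1 : (1 < size e)%N.
  rewrite ltn_neqAle size_poly_gt0 e0 andbT; apply: contraNN fg.
  rewrite eq_sym => /eqP se; rewrite -fE (@dvdp_trans _ d) ?dvdp_gcdl //.
  have /size_poly1P[c c0 ->] : size e == 1%N by rewrite se.
  by rewrite mul_polyC dvdpZl.
have [ir ir_irr /dvdpP[e' eE]] := exists_irreducible_factor e1.
set hb := e' * d; have fE' : fb = ir * hb by rewrite -fE eE /hb; ring.
have hb0 : hb != 0 by apply: contraNneq fb0 => h0; rewrite fE' h0 mulr0.
have [[u1 u2] /= /andP[/dvdpP[w dE] _]] := Bezoutp gb fb.
pose a := polylift (e' * w * u1); pose b := polylift (e' * w * u2).
pose h := polylift hb; pose P := polylift ir.
have [|W WE] := @polymod_eq0 q qp (h - (a * g + b * f)).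
  rewrite modD modN modD !modM !polyliftK -/gb -/fb /hb /d dE.
  by apply/eqP; rewrite subr_eq0; apply/eqP; ring.
have [|F FE] := @polymod_eq0 q qp (f - P * h).
  by rewrite modD modN modM !polyliftK -/fb fE' subrr.
have q0 : q%:R != 0 :> algC by rewrite pnatr_eq0 -lt0n prime_gt0.
pose y := evalZ h / q%:R.
have yq : y * q%:R = evalZ h by rewrite divfK.
have yP : y * evalZ P = - evalZ F.
  have := evalZ_f; have -> : f = P * h + q%:Z *: F by rewrite -FE addrC subrK.
  rewrite evalZD evalZM evalZZ -pmulrn -yq => /eqP; rewrite addr_eq0 => /eqP E.
  by apply: (mulIf q0); rewrite mulNr [_ * q%:R in RHS]mulrC -E; ring.
(* Modulo [q], [h] is a multiple of the gcd [d], hence a combination of [g] and [f]; so [y] inherits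
   integrality from [g(theta) / q]. *)
have yA : y \in Aint.
  have -> : y = evalZ a * (evalZ g / q%:R) + evalZ W.
    apply: (mulIf q0); rewrite yq.
    have -> : h = a * g + b * f + q%:Z *: W by rewrite -WE addrC subrK.
    rewrite !evalZD !evalZM evalZ_f evalZZ -pmulrn mulr0 addr0 mulrDl.
    by rewrite -!mulrA mulVf // mulr1 [q%:R * _]mulrC.
  by apply: rpredD (Aint_evalZ _); apply: rpredM gA; exact: Aint_evalZ.
have yN : ~ inZ y.
  move=> [k yk].
  have /evalZ_eq0[k' kE] : evalZ (h - q%:Z *: k) = 0.
    by rewrite evalZD evalZN evalZZ -pmulrn -yk mulrC yq subrr.
  have := congr1 (polymod q) kE.
  rewrite modD modN modq subr0 modM polyliftK -/fb fE' mulrA => E.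
  have E1 : 1 = polymod q k' * ir.
    by apply: (mulIf hb0); rewrite mul1r.
  have : ir %| 1 by rewrite E1 dvdp_mull.
  by rewrite dvdp1 => /eqP i1; case: ir_irr => + _; rewrite i1.
(* Otherwise [r] is invertible modulo [ir], so a multiple of [y t] is [1 + s] with [s] in the ideal
   generated by [q] and [P(theta)]. As [y] maps this ideal into Z[theta], [inZ_of_integral] would
   put [y] in Z[theta]. *)
have key t (r : {poly int}) : inZ t -> y * t = evalZ r -> ir %| polymod q r.
  move=> ht yt; apply: (contra_notT _ yN).
  rewrite -irreducible_poly_coprime // => /Bezout_eq1_coprimepP[[u v] /= uv].
  have [|s sE] := @polymod_eq0 q qp (polylift u * P + polylift v * r - 1).
    by rewrite modD modN modD !modM !polyliftK uv /polymod rmorph1 subrr.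
  have vr : evalZ (polylift v * r)
      = 1 + (q%:R * evalZ s - evalZ (polylift u) * evalZ P).
    have -> : polylift v * r = 1 + q%:Z *: s - polylift u * P by rewrite -sE; ring.
    have e1' : evalZ 1 = 1 by exact: (evalZC theta 1).
    by rewrite !evalZD evalZN evalZM evalZZ -pmulrn -addrA e1'.
  apply: (inZ_of_integral (t := t * evalZ (polylift v))
    (s := q%:R * evalZ s - evalZ (polylift u) * evalZ P) yA).
  - by apply: inZM => //; exact: inZ_eval.
  - apply: inZD; last by apply/inZN/inZM; exact: inZ_eval.
    by apply: inZM; [exact: (inZ_int _ q) | exact: inZ_eval].
  - by rewrite mulrA yt -vr evalZM mulrC.
  - rewrite mulrBr mulrA yq mulrCA yP mulrN opprK.
    by apply: inZD; apply: inZM; exact: inZ_eval.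
have irh : ir %| polymod q h by apply: (key q%:R) => //; exact: (inZ_int _ q).
have irF : ir %| polymod q F.
  rewrite -dvdpNr -modN; apply: (key (evalZ P)); first exact: inZ_eval.
  by rewrite yP evalZN.
have [|c rc /negP[]] := hyp ir ir_irr.
  rewrite -/fb fE' expr2 dvdp_mul2l ?irredp_neq0 //.
  by move: irh; rewrite polyliftK.
have rootdvd r : ir %| polymod q r -> (q%:Z %| r.[c])%Z.
  move=> /dvdpP[s sE]; rewrite -intr_Fp_eq0 // -polymod_horner sE hornerM.
  by rewrite (rootP rc) mulr0.
(* [ir] divides [P], [h] and [F] modulo [q], so at [c] both summands are divisible by [q ^ 2]. *)
have -> : f = P * h + q%:Z *: F by rewrite -FE addrC subrK.
rewrite hornerD hornerM hornerZ expr2 rpredD //.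
  by apply: dvdz_mul; apply: rootdvd => //; rewrite polyliftK.
by apply: dvdz_mul => //; exact: rootdvd.
Qed.
End DedekindCriterion.

Lemma monogenic_criterion (f : {poly int}) :
    f \is monic -> irreducible_poly (map_poly intr f : {poly rat}) ->
    (forall q, prime q ->
     forall g : {poly 'F_q}, irreducible_poly g -> g ^+ 2 %| polymod q f ->
       exists2 c : int, root g c%:~R & ~~ (q%:Z ^+ 2 %| f.[c])%Z) ->
  monogenic f.
Proof.
move=> fm fi h; split=> // theta ft; apply: is_Zbasis_powers => // q qp.
exact: dedekind_locally_maximal (h q qp).
Qed.

(** * The trinomial *)

Section Trinomial.
Variables (a n p : nat).
Hypotheses (a0 : (0 < a)%N) (n2 : (1 < n)%N).

Local Notation f := (f_poly n a p).

Lemma f_polyE : f = 'X^n + (- (a%:Z *: 'X^(n.-1) + (p%:Z)%:P)).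
Proof. by rewrite /f_poly -addrA opprD. Qed.

Lemma size_f_poly_tail :
  (size (- (a%:Z *: 'X^(n.-1) + (p%:Z)%:P) : {poly int}) < n.+1)%N.
Proof.
rewrite size_polyN (leq_ltn_trans (size_polyD _ _)) // gtn_max.
rewrite (leq_ltn_trans (size_scale_leq _ _)) ?size_polyXn ?prednK ?(ltnW n2) //.
by rewrite (leq_ltn_trans (size_polyC_leq1 _)) // ltnW.
Qed.

Lemma size_f_poly : size f = n.+1.
Proof. by rewrite f_polyE size_polyDl size_polyXn // size_f_poly_tail. Qed.

Lemma f_poly_monic : f \is monic.
Proof.
by rewrite monicE f_polyE lead_coefDl ?lead_coefXn // size_polyXn size_f_poly_tail.
Qed.

Lemma map_f_poly (R : nzRingType) : map_poly intr f
  = 'X^n - a%:R *: 'X^(n.-1) - (p%:R)%:P :> {poly R}.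
Proof.
by rewrite !rmorphB /= map_polyZ !map_polyXn map_polyC /= -!pmulrn.
Qed.

Lemma horner_f_poly (R : comNzRingType) (x : R) :
  (map_poly intr f).[x] = x ^+ n - a%:R * x ^+ n.-1 - p%:R.
Proof. by rewrite map_f_poly !hornerE. Qed.

Lemma root_f_poly (R : comNzRingType) (x : R) : root (map_poly intr f) x ->
  x ^+ n.-1 * (x - a%:R) = p%:R.
Proof.
rewrite rootE horner_f_poly subr_eq0 => /eqP <-.
have -> : x ^+ n = x * x ^+ n.-1 by rewrite -exprS prednK // ltnW.
by ring.
Qed.

Section LargePrime.
Hypotheses (pp : prime p) (pa : (a.+1 < p)%N).

(** If [|x| <= 1], then [p = |x|^(n-1) |x - a| <= 1 + a], against [pa]. *)
Lemma f_poly_root_gt1 (x : algC) : root (map_poly intr f) x -> 1 < `|x|.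
Proof.
move=> /root_f_poly/(congr1 Num.norm); rewrite normrM normrX normr_nat => e.
rewrite real_ltNge ?normr_real ?real1 //; apply/negP => x1.
suff : (p%:R : algC) <= a.+1%:R by rewrite ler_nat leqNgt pa.
rewrite -e; apply: (@le_trans _ _ `|x - a%:R|).
  by rewrite ler_piMl ?normr_ge0 // exprn_ile1 ?normr_ge0.
apply: (le_trans (ler_normB _ _)); rewrite normr_nat -natr1 addrC.
by rewrite lerD2l.
Qed.

(** [|g(0)|] is the product of the moduli of the roots, of which there is at least one. *)
Lemma horner0_gt1 (g : {poly int}) : (1 < size g)%N -> `|lead_coef g| = 1 ->
  (forall x : algC, root (map_poly intr g) x -> 1 < `|x|) -> 1 < `|g.[0]|.
Proof.
move=> sg lg hr; set G : {poly algC} := map_poly intr g.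
have inj : injective (intr : int -> algC) by exact: intr_inj.
have [rs GE] := closed_field_poly_normal G.
have lG : `|lead_coef G| = 1.
  by rewrite lead_coef_map_inj // -intr_norm lg.
have G0 : G != 0 by rewrite -lead_coef_eq0 -normr_eq0 lG oner_neq0.
have rsr z : z \in rs -> 1 < `|z|.
  move=> zrs; apply: hr; rewrite -/G GE rootZ ?root_prod_XsubC //.
  by rewrite lead_coef_eq0.
have rs1 : (0 < size rs)%N.
  have := congr1 (fun h : {poly algC} => size h) GE.
  rewrite size_scale ?lead_coef_eq0 // size_prod_XsubC.
  by rewrite size_map_inj_poly // => sgE; move: sg; rewrite sgE.
have : 1 < `|G.[0]|.
  rewrite GE hornerZ normrM lG mul1r horner_prod normr_prod.
  case: rs rs1 rsr {GE} => // z rs _ rsr.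
  rewrite big_cons hornerXsubC sub0r normrN.
  apply: (@lt_le_trans _ _ `|z|); first by rewrite rsr ?mem_head.
  rewrite ler_peMr ?normr_ge0 // big_seq.
  elim/big_rec: _ => // t x trs x1; rewrite hornerXsubC sub0r normrN.
  have t1 : 1 < `|t| by rewrite rsr // inE trs orbT.
  by apply: (le_trans x1); rewrite ler_peMl ?ltW // (lt_le_trans ltr01).
have -> : G.[0] = (g.[0])%:~R by rewrite -horner_map rmorph0.
by rewrite -intr_norm ltr1z.
Qed.

(** In an integer factorisation the leading coefficients are units, so two nonconstant factors would
    split the prime [p] into two constant terms of absolute value above 1. *)
Lemma f_poly_irreducible : irreducible_poly (map_poly intr f : {poly rat}).
Proof.
apply/irreducible_rat_int; split; first by rewrite size_f_poly ltnS ltnW.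
move=> g sg1 gf.
have f0 : f != 0 by rewrite monic_neq0 // f_poly_monic.
have [r fE] := dvdpP_int gf.
set G := zprimitive g in fE.
have lGr : `|lead_coef G| * `|lead_coef r| = 1.
  by rewrite -normrM -lead_coefM -fE (monicP f_poly_monic).
have hroot (h k : {poly int}) : f = h * k ->
    forall x : algC, root (map_poly intr h) x -> 1 < `|x|.
  move=> fhk x hx; apply: f_poly_root_gt1; rewrite fhk rmorphM rootM hx //.
have g0 : g != 0 by apply: contraNneq f0 => g0; rewrite -dvd0p -g0.
have sG : (1 < size G)%N.
  by rewrite size_zprimitive ltn_neqAle eq_sym sg1 size_poly_gt0.
have lG : `|lead_coef G| = 1.
  move: lGr; rewrite -!abszE -PoszM => -[] /eqP.
  by rewrite muln_eq1 => /andP[/eqP -> _].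
have lr : `|lead_coef r| = 1 by move: lGr; rewrite lG mul1r.
have G1 := horner0_gt1 sG lG (hroot _ _ fE).
have sr : (size r <= 1)%N.
  rewrite leqNgt; apply/negP => sr.
  have r1 := horner0_gt1 sr lr (hroot _ _ (etrans fE (mulrC _ _))).
  have e : `|G.[0]| * `|r.[0]| = p%:Z.
    rewrite -normrM -hornerM -fE /f_poly !hornerE !expr0n.
    rewrite (gtn_eqF (ltnW n2)) (_ : n.-1 == 0%N = false) ?mulr0 ?sub0r ?normrN //.
    by case: n n2 => [|[]].
  move: e G1 r1; rewrite -!abszE -PoszM !ltz_nat => -[] e G1 r1.
  have : (`|G.[0]| %| p)%N by rewrite -e dvdn_mulr.
  move: pp => /primeP[p1 h] /h /orP[/eqP E|/eqP E]; first by rewrite E in G1.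
  by move: e; rewrite E -[RHS]muln1 => /eqP; rewrite eqn_pmul2l; lia.
have r0 : r != 0 by apply: contraNneq f0 => r0; rewrite fE r0 mulr0.
rewrite -dvdp_size_eqp // fE size_mul ?zprimitive_eq0 //.
rewrite size_zprimitive.
have -> : size r = 1%N by apply/eqP; rewrite eqn_leq sr size_poly_gt0.
by rewrite addn1.
Qed.
(** Intermediate values on [[1, a + p]], where [f(1) = 1 - a - p] and
    [f(a + p) = p ((a + p)^(n-1) - 1)]. The root exceeds [a] because [x^(n-1) (x - a) = p] is
    positive. *)
Lemma f_poly_real_root : exists2 la : algC, root (map_poly intr f) la & a%:R < la.
Proof.
have h1 : (map_poly intr f).[1] <= 0 :> algR.
  rewrite horner_f_poly !expr1n mulr1 subr_le0.
  by rewrite (@le_trans _ _ 0) ?ler0n // subr_le0 ler1n.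
have h2 : 0 <= (map_poly intr f).[(a + p)%:R] :> algR.
  rewrite horner_f_poly.
  have -> : ((a + p)%:R : algR) ^+ n = (a + p)%:R * (a + p)%:R ^+ n.-1.
    by rewrite -exprS prednK // ltnW.
  rewrite -mulrBl.
  have -> : (a + p)%:R - a%:R = p%:R :> algR by rewrite natrD addrC addKr.
  by rewrite subr_ge0 ler_peMr ?ler0n // exprn_ege1 // ler1n addn_gt0 a0.
have le12 : 1 <= (a + p)%:R :> algR by rewrite ler1n addn_gt0 a0.
have [x /andP[x1 _] rx] := poly_ivt le12 (introT andP (conj h1 h2)).
have rla : root (map_poly intr f) (val x : algC).
  have -> : map_poly intr f = map_poly algRval (map_poly intr f) :> {poly algC}.
    by rewrite -map_poly_comp; apply: eq_map_poly => z; rewrite /= rmorph_int.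
  exact: rmorph_root.
exists (val x) => //.
have x1' : 1 <= val x :> algC by exact: x1.
have := root_f_poly rla; have p0 : 0 < p%:R :> algC by rewrite ltr0n prime_gt0.
move=> e; move: p0; rewrite -e pmulr_rgt0 ?subr_gt0 //.
by rewrite exprn_gt0 // (lt_le_trans ltr01).
Qed.

(** If [|al| >= la], comparing [|al|^(n-1) |al - a|] with [la^(n-1) (la - a)], both equal to [p],
    forces equality in the triangle inequality [|al| <= |al - a| + a]. Hence [al - a] is a
    nonnegative real and [al = la]. *)
Lemma f_poly_root_norm (la al : algC) : root (map_poly intr f) la -> a%:R < la ->
  root (map_poly intr f) al -> al <> la -> `|al| < la.
Proof.
move=> rla ala ral neq.
have aP : 0 < a%:R :> algC by rewrite ltr0n.
have la0 : 0 < la by apply: lt_trans ala.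
have ela := root_f_poly rla.
have := congr1 Num.norm (root_f_poly ral); rewrite normrM normrX normr_nat -ela => e.
have laR : la \is Num.real by rewrite gtr0_real.
rewrite real_ltNge ?normr_real //; apply/negP => le.
have d0 : 0 < la - a%:R by rewrite subr_gt0.
have d1 : la - a%:R <= `|al| - a%:R by rewrite lerD2r.
have d2 : `|al| - a%:R <= `|al - a%:R|.
  by rewrite lerBlDr; have := ler_normD (al - a%:R) a%:R; rewrite subrK normr_nat.
have pw : la ^+ n.-1 <= `|al| ^+ n.-1 by rewrite lerXn2r ?nnegrE ?normr_ge0 ?(ltW la0).
have pw0 : 0 < la ^+ n.-1 by rewrite exprn_gt0.
have eq : `|al - a%:R| = la - a%:R.
  apply/le_anti/andP; split; last exact: le_trans d2.
  by rewrite -(ler_pM2l pw0) -e ler_wpM2r ?normr_ge0.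
have eqn : `|al| = la.
  apply/le_anti/andP; split=> //; rewrite eq lerD2r in d2; exact: d2.
have := @normCDeq _ (al - a%:R) a%:R.
rewrite subrK eq normr_nat eqn subrK => /(_ erefl)[t t1 [e1 e2]].
have t1' : t = 1 by apply: (mulfI (lt0r_neq0 aP)); rewrite mulr1 -e2.
by apply: neq; move: e1; rewrite t1' mulr1 => /addIr.
Qed.

Lemma f_poly_strictly_perron : strictly_perron_poly f.
Proof.
have [la rla ala] := f_poly_real_root.
have la0 : 0 < la by apply: le_lt_trans ala; rewrite ler0n.
have la1 : 1 < la by have := f_poly_root_gt1 rla; rewrite gtr0_norm.
have minE : minCpoly la = map_poly intr f.
  exact (minCpoly_irreducible f_poly_monic f_poly_irreducible rla).
have conjE al : conjugate la al = (root (map_poly intr f) al).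
  by rewrite /conjugate minE.
exists la; split; first by rewrite /is_min_poly minE.
- split; last by move=> al; rewrite conjE; exact: f_poly_root_norm.
  split; [exact: gtr0_real | | exact: la1].
  exact (Aint_theta f_poly_monic rla).
- move=> [_ h].
  (* If [la] were Pisot, it would be the only root, so [f = (X - la)^n] and [p = la^n]; then
     [f(la) = 0] gives [a la^(n-1) = 0], which is absurd. *)
  have all_la al : root (map_poly intr f) al -> al = la.
    move=> ral; apply/eqP; apply/negPn/negP => /eqP neq.
    have := h al; rewrite conjE => /(_ ral neq) al1.
    by have := lt_trans al1 (f_poly_root_gt1 ral); rewrite ltxx.
  set G : {poly algC} := map_poly intr f.
  have [rs GE] := closed_field_poly_normal G.
  have Gm : G \is monic by rewrite monic_map // f_poly_monic.
  rewrite (monicP Gm) scale1r in GE.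
  have srs : size rs = n.
    have := congr1 (fun h : {poly algC} => size h) GE.
    rewrite size_prod_XsubC size_map_inj_poly ?size_f_poly //; first by case.
    exact: intr_inj.
  have : `|G.[0]| = la ^+ n.
    have -> : la ^+ n = \prod_(z <- rs) la.
      by rewrite big_const_seq count_predT iter_mulr_1 srs.
    rewrite GE horner_prod normr_prod.
    rewrite big_seq [RHS]big_seq; apply: eq_bigr => z zrs.
    rewrite hornerXsubC sub0r normrN (all_la z) ?gtr0_norm //.
    by rewrite -/G GE root_prod_XsubC.
  rewrite /G horner_f_poly !expr0n (gtn_eqF (ltnW n2)).
  rewrite (_ : n.-1 == 0%N = false); last by case: (n) n2 => [|[]].
  rewrite mulr0 subr0 sub0r normrN normr_nat => e.
  have := rla; rewrite rootE horner_f_poly -e addrAC subrr add0r oppr_eq0.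
  by rewrite mulf_eq0 pnatr_eq0 expf_eq0 (gt_eqF la0) andbF orbF; case: (a) a0.
- move=> [_ [al [[+ al1] _]] _]; rewrite conjE => /f_poly_root_gt1 al2.
  by have := lt_trans al1 al2; rewrite ltxx.
- move=> [_ _ + _]; rewrite conjE => /f_poly_root_gt1.
  rewrite normfV gtr0_norm // invf_gt1 // => /(lt_trans la1).
  by rewrite ltxx.
Qed.
Lemma f_poly_monogenic : coprime a n ->
    (forall q, prime q -> ~~ (q ^ 2 %| n ^ n * p + a ^ n * n.-1 ^ n.-1)%N) ->
  monogenic f.
Proof.
move=> can sqf; apply: monogenic_criterion f_poly_monic f_poly_irreducible _.
move=> q qp g g_irr /dvdpP[k fE].
have n0 : (0 < n)%N := ltnW n2.
have fbE : polymod q f = 'X^n - a%:R *: 'X^(n.-1) - (p%:R)%:P by exact: map_f_poly.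
have gf : g %| polymod q f by rewrite fE expr2 mulrA dvdp_mull.
have nat0 (m : nat) : (m%:R == 0 :> 'F_q) = (q %| m)%N.
  by rewrite (dvdn_pcharf (pchar_Fp qp)).
pose L : {poly 'F_q} := n%:R *: 'X - (a%:R * n.-1%:R)%:P.
have gf' : g %| 'X^(n.-2) * L.
  have -> : 'X^(n.-2) * L = (polymod q f)^`().
    rewrite fbE !derivB derivZ !derivXn derivC subr0 /L.
    case: (n) n2 => [|[|m]] // _ /=; rewrite mulrBr -mulr_natl -!mul_polyC.
    by rewrite !polyCM -[in RHS]mulr_natl !polyC_natr exprS; ring.
  rewrite fE expr2 !derivM; apply: dvdp_add; first by rewrite mulrA dvdp_mull.
  by apply/dvdp_mull/dvdp_add; [exact: dvdp_mull | exact: dvdp_mulr].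
have g_sz : (1 < size g)%N by case: g_irr.
have size2_root (l : {poly 'F_q}) (c : 'F_q) : (size l <= 2)%N -> l != 0 ->
    root l c -> g %| l -> root g c.
  move=> sl l0 lc gl; have : g %= l.
    by rewrite -dvdp_size_eqp // eqn_leq dvdp_leq // (leq_trans sl).
  by move=> /eqp_root ->.
(* If [g] does not divide [L], it divides [X]; then [c = 0] and [q] divides [f(0) = -p], so [q = p],
   whose square does not divide [p]. *)
case: (boolP (g %| L)) => gL; last first.
  have gX : g %| 'X.
    move: gf'; rewrite Gauss_dvdpl ?irreducible_poly_coprime // => gXn.
    apply: contraTT gXn; rewrite -!irreducible_poly_coprime //.
    exact: coprimep_expr.
  have g0 : root g (0 : int)%:~R.
    by apply: (size2_root 'X); rewrite ?size_polyX ?polyX_eq0 ?rootX.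
  exists 0 => //.
  have f0 : f.[0] = - p%:Z.
    rewrite /f_poly !hornerE !expr0n (gtn_eqF n0) (_ : n.-1 == 0%N = false).
      by rewrite mulr0 !sub0r.
    by case: (n) n2 => [|[]].
  have : (q %| p)%N.
    have /dvdpP[k0 k0E] := gf; have := polymod_horner q f 0.
    rewrite k0E hornerM (rootP g0) mulr0 f0 mulrNz -pmulrn -nat0 => /esym/eqP.
    by rewrite oppr_eq0.
  rewrite dvdn_prime2 // => /eqP qE; rewrite f0 dvdzE abszN abszX /= qE.
  apply/negP => /(dvdn_leq (prime_gt0 pp)).
  by rewrite leqNgt -{1}(expn1 p) ltn_exp2l ?prime_gt1.
(* Otherwise [L] is the constant [- a (n-1)], nonzero since [q] divides neither [a] nor [n - 1]. *)
have qn : ~~ (q %| n)%N.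
  apply/negP => qn; have : g %| L by [].
  have -> : L = - (a%:R * n.-1%:R)%:P.
    by rewrite /L; move: qn; rewrite -nat0 => /eqP ->; rewrite scale0r sub0r.
  rewrite dvdpNr => /dvdp_leq; rewrite polyC_eq0 -natrM nat0 Euclid_dvdM //.
  have -> : (q %| a)%N = false.
    apply/negP => qa; have : (q %| gcdn a n)%N by rewrite dvdn_gcd qa.
    by rewrite (eqP can) dvdn1 => /eqP q1; rewrite q1 in qp.
  have -> : (q %| n.-1)%N = false.
    apply/negP => qn1; have : (q %| n - n.-1)%N by rewrite dvdn_sub.
    by rewrite -subn1 subKn // dvdn1 => /eqP q1; rewrite q1 in qp.
  by move=> /(_ isT); rewrite leqNgt (leq_ltn_trans (size_polyC_leq1 _)).
have cop : coprimez n%:Z (q%:Z ^+ 2).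
  by rewrite coprimezE abszX /= coprimeXr // coprime_sym prime_coprime.
have [[u v] /= uv] := coprimezP _ _ cop.
(* The root of [L] is lifted modulo [q ^ 2], not only modulo [q], so that [f(c)] can be evaluated
   modulo [q ^ 2]. *)
pose c : int := u * (a%:Z * n.-1%:Z).
have nc : (n%:Z * c = a%:Z * n.-1%:Z %[mod q%:Z ^+ 2])%Z.
  apply/eqP; rewrite eqz_mod_dvd; apply/dvdzP; exists (- v * (a%:Z * n.-1%:Z)).
  have -> : n%:Z * c = (u * n%:Z) * (a%:Z * n.-1%:Z) by rewrite /c; ring.
  have -> : u * n%:Z = 1 - v * q%:Z ^+ 2 by rewrite -uv; ring.
  by ring.
exists c.
  apply: (size2_root L) => //.
  - rewrite (leq_trans (size_polyD _ _)) // geq_max size_polyN.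
    rewrite (leq_trans (size_scale_leq _ _)) ?size_polyX //=.
    by rewrite (leq_trans (size_polyC_leq1 _)).
  - apply/eqP => L0; have := congr1 (fun h : {poly 'F_q} => h`_1) L0.
    rewrite coefB coefZ coefX coefC coef0 /= mulr1 subr0 => /eqP.
    by rewrite nat0 (negPf qn).
  - rewrite rootE /L !hornerE -natrM !pmulrn -intrM -rmorphB /= intr_Fp_eq0 //.
    move/eqP: nc; rewrite eqz_mod_dvd PoszM; apply: dvdz_trans.
    by rewrite expr2 dvdz_mulr.
apply/negP => qf; have /negP[] := sqf q qp.
have {}qf : (q%:Z ^+ 2 %| n%:Z ^+ n * f.[c])%Z by rewrite dvdz_mull.
pose x : int := n%:Z * c; pose t : int := a%:Z * n.-1%:Z.
have xt k' : (q%:Z ^+ 2 %| x ^+ k' - t ^+ k')%Z.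
  by rewrite subrXX dvdz_mulr // -eqz_mod_dvd; apply/eqP.
have S (y : int) : y ^+ n = y * y ^+ n.-1 by rewrite -exprS prednK.
(* With [x = n c] congruent to [t = a (n-1)], the number [n^n f(c)] is congruent to
   [t^n - a n t^(n-1) - n^n p], and [t - a n = -a] makes this minus the discriminant factor. *)
have E : n%:Z ^+ n * p%:Z + a%:Z ^+ n * n.-1%:Z ^+ n.-1
    = (x ^+ n - t ^+ n) - a%:Z * n%:Z * (x ^+ n.-1 - t ^+ n.-1) - n%:Z ^+ n * f.[c].
  have -> : f.[c] = c ^+ n - a%:Z * c ^+ n.-1 - p%:Z by rewrite /f_poly !hornerE.
  rewrite !S /x /t !exprMn.
  have nE : n%:Z = n.-1%:Z + 1 by rewrite -PoszD addn1 prednK.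
  by move: nE; set m := n.-1%:Z => nE; rewrite nE; ring.
have : (q%:Z ^+ 2 %| n%:Z ^+ n * p%:Z + a%:Z ^+ n * n.-1%:Z ^+ n.-1)%Z.
  rewrite E; apply: rpredB qf; apply: rpredB; first exact: xt.
  by apply: dvdz_mull; exact: xt.
have PX (m e : nat) : (m ^ e)%:Z = m%:Z ^+ e.
  by elim: e => // e IH; rewrite expnS PoszM IH exprS.
by rewrite -!PX -!PoszM -PoszD dvdzE.
Qed.
End LargePrime.
End Trinomial.

Theorem theorem1p1 (a : int) (n : nat) (ha : 1 <= a) (hn : (2 <= n)%N)
    (hgcd : gcdz a n%:Z = 1) :
  forall N : nat, exists p : nat,
    [/\ (N < p)%N, prime p, monogenic (f_poly n a p)
      & strictly_perron_poly (f_poly n a p)].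
Proof.
case: a ha hgcd => // a a0 [can] N.
have n0 : (0 < n)%N := ltnW hn.
have [] := @infinitely_many_primes_squarefree (n ^ n)%N (a ^ n * n.-1 ^ n.-1)%N
  (maxn N a.+1).
- have cn : coprime n a by rewrite coprime_sym; apply/eqP.
  have cn1 : coprime n n.-1 by rewrite -{1}(prednK n0) coprimeSn.
  by rewrite coprimeXl // coprimeMr !coprimeXr.
(* Exactly one of the two summands is odd: for [n] odd, [n - 1] is even; for [n] even, both [n - 1]
   and [a] are odd, the latter by coprimality. *)
- move=> m om; rewrite oddD !oddM !oddX om andbT.
  rewrite -[n == 0%N]negbK -lt0n n0 -[n.-1 == 0%N]negbK -lt0n -ltnS prednK // hn /=.
  have -> : odd n.-1 = ~~ odd n by rewrite -[n in RHS](prednK n0) /= negbK.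
  case: (boolP (odd n)) => on; rewrite ?andbF ?andbT //=.
  apply/negPn/negP => ea.
  have : (2 %| gcdn a n)%N by rewrite dvdn_gcd !dvdn2 ea.
  by rewrite can.
- move=> p []; rewrite gtn_max => /andP[Np ap] pp sqf; exists p; split=> //.
    by apply: f_poly_monogenic => //; apply/eqP.
  exact: f_poly_strictly_perron.
Qed.
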